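(* Let $\mathcal{J}$ be a set of $n$ jobs (unit rewards). For any $\varepsilon>0$, there exists a fully dynamic algorithm for $(1+\varepsilon)$-approximate unweighted interval scheduling of $\mathcal{J}$ on $M$ machines performing updates in $O\left(\frac{M\log n}{\varepsilon}\right)$ worst-case time and queries in $O(\log n)$ worst-case time.
   Context: Interval scheduling on $M$ machines: each job $j$ has a start time $s_j\ge0$ and length $l_j\ge1$ (occupying $[s_j,s_j+l_j]$); a feasible schedule assigns a subset of the jobs to the $M$ machines such that jobs on the same machine pairwise do not overlap; in the unweighted case the goal is to maximize the number of scheduled jobs. A solution is $(1+\varepsilon)$-approximate if its value is at least $1/(1+\varepsilon)$ times the optimum. A fully dynamic algorithm maintains a feasible solution under insertions and deletions of jobs and answers queries about it (e.g., whether a given job is scheduled). *)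

(* Defs.v *)
From HB Require Import structures.
From mathcomp Require Import all_boot all_order all_algebra.
From mathcomp Require Import finmap.
From mathcomp Require Import reals exp.

Set Implicit Arguments.
Unset Strict Implicit.
Unset Printing Implicit Defensive.

Import Order.TTheory GRing.Theory Num.Theory.
Local Open Scope fset_scope.
Local Open Scope ring_scope.

(* Jobs and schedules. A job is (identifier, start, length); the identifier
   allows distinct jobs that occupy the same interval. *)
Section Scheduling.
Variable R : realType.

Definition job := (nat * R * R)%type.
Definition job_id (j : job) : nat := j.1.1.
Definition job_start (j : job) : R := j.1.2.
Definition job_length (j : job) : R := j.2.
Definition job_end (j : job) : R := job_start j + job_length j.

Definition valid_job (j : job) : bool := (0 <= job_start j) && (1 <= job_length j).

(* A job may start at the moment another one ends. *)
Definition overlap (i j : job) : bool :=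
  (job_start i < job_end j) && (job_start j < job_end i).

Definition schedule (M : nat) (J : {fset job}) := {ffun J -> option 'I_M}.

Definition feasible M (J : {fset job}) (s : schedule M J) : bool :=
  [forall i : J, forall j : J,
    [&& i != j, s i != None & s i == s j] ==> ~~ overlap (val i) (val j)].

Definition schedule_value M (J : {fset job}) (s : schedule M J) : nat :=
  #|[pred j | s j != None]|.

Definition opt_value M (J : {fset job}) : nat :=
  \max_(s : schedule M J | feasible s) schedule_value s.

Definition approximate (eps : R) M (J : {fset job}) (s : schedule M J) : Prop :=
  (1 + eps)^-1 * (opt_value M J)%:R <= (schedule_value s)%:R.

End Scheduling.

(* Model of computation: a unit-cost real RAM, programmed in a first-order
   language with recursive functions. Words hold a natural number, a real
   number, a null pointer or a pointer to an immutable two-field record; the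
   memory has a cell for every natural address. Every evaluation rule charges
   one unit on top of the cost of the subexpressions. Variables are de Bruijn
   indices into the local environment, whose size is bounded by the text of the
   program, so a rule is a constant number of steps on a random access machine.
   There is no product of natural numbers, no rounding of reals, and no real
   literal other than the images of natural numbers. *)
Variant op1 := Fst | Snd | IsPair | IsNull | RealOfNat.

Variant op2 :=
  MkPair | NatAdd | NatSub | NatLe
| RealAdd | RealSub | RealMul | RealDiv | RealLe.

Inductive expr :=
| Var of nat
| NatLit of nat
| NullLit
| Op1 of op1 & expr
| Op2 of op2 & expr & expr
| Let of expr & expr
| If of expr & expr & expr
| Fetch of expr
| Store of expr & expr
| Call of nat & expr.

(* Function f takes one argument and its body is the f-th entry. *)
Definition program := seq expr.

Section Semantics.
Variable R : realType.

Inductive value :=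
| VNull
| VNat of nat
| VReal of R
| VPair of value & value.

Definition memory := nat -> value.

Definition empty_memory : memory := fun _ => VNull.

Definition write (m : memory) (a : nat) (v : value) : memory :=
  fun b => if b == a then v else m b.

Definition vbool (b : bool) : value := VNat (nat_of_bool b).

Definition eval_op1 (o : op1) (v : value) : option value :=
  match o, v with
  | Fst, VPair x _ => Some x
  | Snd, VPair _ y => Some y
  | IsPair, VPair _ _ => Some (vbool true)
  | IsPair, _ => Some (vbool false)
  | IsNull, VNull => Some (vbool true)
  | IsNull, _ => Some (vbool false)
  | RealOfNat, VNat n => Some (VReal n%:R)
  | _, _ => None
  end.

Definition eval_op2 (o : op2) (v w : value) : option value :=
  match o, v, w with
  | MkPair, _, _ => Some (VPair v w)
  | NatAdd, VNat a, VNat b => Some (VNat (a + b)%N)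
  | NatSub, VNat a, VNat b => Some (VNat (a - b)%N)
  | NatLe, VNat a, VNat b => Some (vbool (a <= b)%N)
  | RealAdd, VReal x, VReal y => Some (VReal (x + y))
  | RealSub, VReal x, VReal y => Some (VReal (x - y))
  | RealMul, VReal x, VReal y => Some (VReal (x * y))
  | RealDiv, VReal x, VReal y => Some (VReal (x / y))
  | RealLe, VReal x, VReal y => Some (vbool (x <= y))
  | _, _, _ => None
  end.

(* [eval P env m e v m' t]: in environment env and memory m, e terminates with
   value v and memory m' after t steps. *)
Inductive eval (P : program) :
  seq value -> memory -> expr -> value -> memory -> nat -> Prop :=
| EvVar env m i : (i < size env)%N ->
    eval P env m (Var i) (nth VNull env i) m 1
| EvNat env m n : eval P env m (NatLit n) (VNat n) m 1
| EvNull env m : eval P env m NullLit VNull m 1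
| EvOp1 env m m1 o e v w t :
    eval P env m e v m1 t -> eval_op1 o v = Some w ->
    eval P env m (Op1 o e) w m1 t.+1
| EvOp2 env m m1 m2 o e1 e2 v1 v2 w t1 t2 :
    eval P env m e1 v1 m1 t1 -> eval P env m1 e2 v2 m2 t2 ->
    eval_op2 o v1 v2 = Some w ->
    eval P env m (Op2 o e1 e2) w m2 (t1 + t2).+1
| EvLet env m m1 m2 e1 e2 v1 v2 t1 t2 :
    eval P env m e1 v1 m1 t1 -> eval P (v1 :: env) m1 e2 v2 m2 t2 ->
    eval P env m (Let e1 e2) v2 m2 (t1 + t2).+1
| EvIf env m m1 m2 c e1 e2 n v t1 t2 :
    eval P env m c (VNat n) m1 t1 ->
    eval P env m1 (if n == 0%N then e2 else e1) v m2 t2 ->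
    eval P env m (If c e1 e2) v m2 (t1 + t2).+1
| EvLoad env m m1 e a t :
    eval P env m e (VNat a) m1 t ->
    eval P env m (Fetch e) (m1 a) m1 t.+1
| EvStore env m m1 m2 e1 e2 a v t1 t2 :
    eval P env m e1 (VNat a) m1 t1 -> eval P env m1 e2 v m2 t2 ->
    eval P env m (Store e1 e2) VNull (write m2 a v) (t1 + t2).+1
| EvCall env m m1 m2 f e v w t1 t2 :
    (f < size P)%N ->
    eval P env m e v m1 t1 -> eval P [:: v] m1 (nth NullLit P f) w m2 t2 ->
    eval P env m (Call f e) w m2 (t1 + t2).+1.

Lemma eval_det P env m e v m' t v2 m2 t2 :
  eval P env m e v m' t -> eval P env m e v2 m2 t2 ->
  [/\ v = v2, m' = m2 & t = t2].
Proof.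
move=> ev; move: v2 m2 t2; induction ev => vz mz tz evz; inversion evz; subst;
  repeat match goal with
  | IH : forall v m t, eval P ?en ?mm ?ee v m t -> _,
    H : eval P ?en ?mm ?ee _ _ _ |- _ =>
      let E := fresh "E" in
      case: (IH _ _ _ H) => E *; clear H; try injection E as E; subst
  end; split => //; congruence.
Qed.

End Semantics.

Record algorithm := Algorithm {
  code : program;
  insert_code : expr;
  delete_code : expr;
  query_code : expr }.

Section DynamicAlgorithm.
Variable R : realType.

Definition job_word (j : job R) : value R :=
  VPair (VNat R (job_id j)) (VPair (VReal (job_start j)) (VReal (job_length j))).

(* The answer to a query: 0 for a job that is not scheduled, k + 1 for a job
   scheduled on machine k. *)
Definition answer_word M (a : option 'I_M) : value R :=
  VNat R (if a is Some k then k.+1 else 0%N).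

(* Every operation receives the parameters of the problem and a job. *)
Definition run (A : algorithm) (e : expr) (eps : R) (M : nat) (m : memory R)
    (j : job R) (v : value R) (m' : memory R) (t : nat) : Prop :=
  eval (code A) [:: job_word j; VNat R M; VReal eps] m e v m' t.

(* Started on the empty set of jobs with a blank memory, A maintains a feasible
   (1 + eps)-approximate schedule through every sequence of insertions,
   deletions and queries, in worst-case time at most update_time n per update
   and query_time n per query, where n is the number of jobs present when the
   operation is called. [rep J s m] says that the memory m is one that A may
   have reached with current jobs J and maintained schedule s; a query may
   modify the memory but not the schedule. *)
Definition dynamic_scheduling (A : algorithm) (eps : R) (M : nat)
    (update_time query_time : nat -> R) : Prop :=
  exists rep : forall J : {fset job R}, schedule M J -> memory R -> Prop,
  [/\ exists s : schedule M fset0, rep fset0 s (empty_memory R),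
      forall (J : {fset job R}) (s : schedule M J) m, rep J s m ->
        feasible s /\ approximate eps s,
      forall (J : {fset job R}) (s : schedule M J) m j, rep J s m ->
        valid_job j -> j \notin J ->
        exists v m' t (s' : schedule M (j |` J)),
          [/\ run A (insert_code A) eps M m j v m' t,
              t%:R <= update_time #|` J| & rep (j |` J) s' m'],
      forall (J : {fset job R}) (s : schedule M J) m j, rep J s m ->
        j \in J ->
        exists v m' t (s' : schedule M (J `\ j)),
          [/\ run A (delete_code A) eps M m j v m' t,
              t%:R <= update_time #|` J| & rep (J `\ j) s' m'] &
      forall (J : {fset job R}) (s : schedule M J) m (j : J), rep J s m ->
        exists m' t,
          [/\ run A (query_code A) eps M m (val j) (answer_word (s j)) m' t,
              t%:R <= query_time #|` J| & rep J s m']].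

End DynamicAlgorithm.

(* Main.v *)
(** Time is cut by borders into regions, and every region keeps a maximum
    schedule of the jobs that lie inside it. A schedule on [M] machines has at
    most [M] jobs across a border, so the loss is at most [M] per border; two
    neighbouring regions always hold at least [2 M / eps] scheduled jobs
    together, hence the loss is at most [eps] times the value.

    A region is solved by the best-fit greedy algorithm in the order of end
    times. A balanced tree ordered by start, in which every node stores the
    earliest ending unscheduled job below it, yields the next job in logarithmic
    time, so the cost is governed by the number of scheduled jobs. The greedy run
    puts a new border when the schedule reaches [U = T + M] jobs, where
    [T = 2 M / eps + 2], and two neighbours with fewer than [T] jobs are merged,
    after which they have fewer than [U] jobs. Since an update changes the
    optimum of its region by at most one, it re-solves a bounded number of
    regions of [O (M / eps)] scheduled jobs. *)

From mathcomp Require Import all_boot all_order all_algebra.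
From mathcomp Require Import finmap.
From mathcomp Require Import reals exp.
From mathcomp Require Import zify lra.
Require Import Defs.

Set Implicit Arguments.
Unset Strict Implicit.
Unset Printing Implicit Defensive.

Import Order.TTheory GRing.Theory Num.Theory.

(** * Counting calls *)

(** The delicate point is equality at a border. A full greedy run sets the border at the end of the
    job it would take next, and jobs already taken may end at that very moment. Hence a region may
    hold jobs that end at its right border, but is optimal only against jobs that end strictly
    before it. A run that stops at an existing border refuses jobs that end there, so every region
    below [U] has strict ends, and its jobs count as a competitor when it is merged with its
    neighbour. [U - T = M] is the number of jobs that can cross one border: any schedule of two
    neighbours that hold fewer than [T] jobs together has fewer than [U], so the merged run never
    meets the cap. A region with [U] jobs satisfies the condition on neighbours by itself; only the
    two ends of a re-solved stretch need a test. The logarithms must be in [n], whatever [M] and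
    [eps] are. The summand 2 in [T] keeps the borders from outnumbering the jobs by more than one
    when [eps] is large, and machines are opened only on first use when [M] is large. Trees are
    immutable, so all functions are pure and their cost is measured in calls, independently of the
    memory. *)

Fixpoint esize (e : expr) : nat :=
  match e with
  | Var _ | NatLit _ | NullLit => 1
  | Op1 _ e | Fetch e | Call _ e => (esize e).+1
  | Op2 _ e1 e2 | Let e1 e2 | Store e1 e2 => (esize e1 + esize e2).+1
  | If c e1 e2 => (esize c + esize e1 + esize e2).+1
  end.

Section CallCounting.
Variables (R : realType) (P : program).
Notation value := (value R).

Definition call_cost : nat := sumn (map esize P).

(* Apart from calls, an evaluation visits each node of a program text at most
   once, so the time is bounded by [call_cost] times the number of calls. *)
Definition pcall (f : nat) (v w : value) (n : nat) : Prop :=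
  f < size P /\ forall m, exists2 t, t <= call_cost * n &
    eval P [:: v] m (nth NullLit P f) w m t.

(* Weakest precondition for the pure fragment; the postcondition receives the
   result and the number of calls. *)
Fixpoint wp (e : expr) (env : seq value) (Q : value -> nat -> Prop) : Prop :=
  match e with
  | Var i => if onth env i is Some v then Q v 0 else False
  | NatLit n => Q (VNat R n) 0
  | NullLit => Q (VNull R) 0
  | Op1 o e => wp e env (fun v n =>
      if eval_op1 o v is Some w then Q w n else False)
  | Op2 o e1 e2 => wp e1 env (fun v1 n1 => wp e2 env (fun v2 n2 =>
      if eval_op2 o v1 v2 is Some w then Q w (n1 + n2) else False))
  | Let e1 e2 => wp e1 env (fun v1 n1 => wp e2 (v1 :: env) (fun v n =>
      Q v (n1 + n)))
  | If c e1 e2 => wp c env (fun v n0 =>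
      match v with
      | VNat 0 => wp e2 env (fun v n => Q v (n0 + n))
      | VNat _.+1 => wp e1 env (fun v n => Q v (n0 + n))
      | _ => False
      end)
  | Fetch _ | Store _ _ => False
  | Call f e => wp e env (fun v n0 =>
      exists w n, pcall f v w n /\ Q w (n0 + n))
  end.

(** [wp] never mentions the memory, so one result and one number of calls serve for all memories. *)
Lemma wp_sound e env Q : wp e env Q ->
  exists v n, Q v n /\ forall m, exists2 t,
    t <= esize e + call_cost * n & eval P env m e v m t.
Proof.
elim: e env Q => /=.
- move=> i env Q; case Ei: (onth env i) => [v|//] HQ; exists v, 0; split=> // m.
  exists 1; first by lia.
  rewrite -(onth_nth (VNull R) _ _ _ Ei); constructor.
  by rewrite -onthTE Ei.
- move=> n env Q HQ; do 2 eexists; split; first exact: HQ.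
  by move=> m; exists 1; [lia | constructor].
- move=> env Q HQ; do 2 eexists; split; first exact: HQ.
  by move=> m; exists 1; [lia | constructor].
- move=> o e IH env Q /IH[v [n []]].
  case Ho: eval_op1 => [w|//] HQ ev; exists w, n; split=> // m.
  by have [t le_t et] := ev m; exists t.+1; [lia | apply: EvOp1 Ho].
- move=> o e1 IH1 e2 IH2 env Q /IH1[v1 [n1 [/IH2[v2 [n2 []]]]]].
  case Ho: eval_op2 => [w|//] HQ ev2 ev1; exists w, (n1 + n2); split=> // m.
  have [t1 le1 et1] := ev1 m; have [t2 le2 et2] := ev2 m.
  by exists (t1 + t2).+1; [nia | apply: EvOp2 et1 et2 Ho].
- move=> e1 IH1 e2 IH2 env Q /IH1[v1 [n1 [/IH2[v2 [n2 []]]]]] HQ ev2 ev1.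
  exists v2, (n1 + n2); split=> // m.
  have [t1 le1 et1] := ev1 m; have [t2 le2 et2] := ev2 m.
  by exists (t1 + t2).+1; [nia | apply: EvLet et1 et2].
- move=> c IHc e1 IH1 e2 IH2 env Q /IHc[v0 [n0 []]].
  case: v0 => [//|[|k]|//|//].
  + move=> /IH2[v [n [HQ ev]]] evc; exists v, (n0 + n); split=> // m.
    have [t1 le1 et1] := evc m; have [t2 le2 et2] := ev m.
    by exists (t1 + t2).+1; [nia | apply: EvIf et1 _].
  + move=> /IH1[v [n [HQ ev]]] evc; exists v, (n0 + n); split=> // m.
    have [t1 le1 et1] := evc m; have [t2 le2 et2] := ev m.
    by exists (t1 + t2).+1; [nia | apply: EvIf et1 _].
- by [].
- by [].
- move=> f e IH env Q /IH[v [n0 [[w [n [[lt_f pc] HQ]]]]]] ev.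
  exists w, (n0 + n); split=> // m.
  have [t1 le1 et1] := ev m; have [t2 le2 et2] := pc m.
  by exists (t1 + t2).+1; [nia | apply: EvCall et1 et2].
Qed.

Lemma wp_mono e env (Q Q' : value -> nat -> Prop) :
  (forall v n, Q v n -> Q' v n) -> wp e env Q -> wp e env Q'.
Proof.
elim: e env Q Q' => /=.
- by move=> i env Q Q' QQ'; case: onth => [v|//]; apply: QQ'.
- by move=> n env Q Q' QQ'; apply: QQ'.
- by move=> env Q Q' QQ'; apply: QQ'.
- move=> o e IH env Q Q' QQ'; apply: IH => v n.
  by case: eval_op1 => [w|//]; apply: QQ'.
- move=> o e1 IH1 e2 IH2 env Q Q' QQ'; apply: IH1 => v1 n1; apply: IH2 => v2 n2.
  by case: eval_op2 => [w|//]; apply: QQ'.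
- move=> e1 IH1 e2 IH2 env Q Q' QQ'; apply: IH1 => v1 n1.
  by apply: IH2 => v2 n2; apply: QQ'.
- move=> c IHc e1 IH1 e2 IH2 env Q Q' QQ'; apply: IHc => v0 n0.
  by case: v0 => [//|[|k]|//|//]; [apply: IH2 | apply: IH1] => v n; apply: QQ'.
- by [].
- by [].
move=> f e IH env Q Q' QQ'; apply: IH => v n0 [w [n [pc HQ]]].
by exists w, n; split=> //; apply: QQ'.
Qed.

(** Trades the exact number of calls of [e1] for a bound, so that long chains of [Let] carry
    inequalities instead of nested sums. *)
Lemma wp_let v n e1 e2 env Q :
  wp e1 env (fun v' n' => v' = v /\ n' <= n) ->
  (forall n', n' <= n -> wp e2 (v :: env) (fun w k => Q w (n' + k))) ->
  wp (Let e1 e2) env Q.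
Proof.
by move=> H1 H2; apply: wp_mono H1 => _ n' [-> le_n]; apply: H2.
Qed.

Lemma wp_if (b : bool) c e1 e2 env Q :
  wp c env (fun v n => v = vbool R b /\ n = 0) ->
  wp (if b then e1 else e2) env Q -> wp (If c e1 e2) env Q.
Proof.
move=> H1 H2; apply: wp_mono H1 => _ _ [-> ->].
by case: b H2; apply: wp_mono.
Qed.

Lemma esize_body f : f < size P -> esize (nth NullLit P f) <= call_cost.
Proof.
rewrite /call_cost; elim: (P) f => [//|e Q IH] [|f] /=; first lia.
by move/IH; lia.
Qed.

(** The strict inequality leaves one unit of [call_cost], which pays for the text of the body
    itself. *)
Lemma pcall_body f v w n : f < size P ->
  wp (nth NullLit P f) [:: v] (fun w' n' => w' = w /\ n' < n) -> pcall f v w n.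
Proof.
move=> lt_f /wp_sound[_ [n' [[-> lt_n] ev]]]; split=> // m.
have [t le_t et] := ev m; exists t => //.
by have := esize_body lt_f; nia.
Qed.

Lemma pcall_le f v w n n' : n <= n' -> pcall f v w n -> pcall f v w n'.
Proof.
move=> le_n [lt_f pc]; split=> // m; have [t le_t et] := pc m.
by exists t => //; nia.
Qed.

End CallCounting.

(** * Balanced search trees *)

Section KeyOrder.
Variable R : realType.
Notation job := (job R).

(** Lexicographic by start, length and identifier, as nested tests that mirror the code of [KLE].
    With the length before the identifier, artificial keys of length 0 or -1 precede all valid jobs
    with the same start. *)
Definition kle (x y : job) : bool :=
  if (job_start x <= job_start y)%R then
    if (job_start y <= job_start x)%R then
      if (job_length x <= job_length y)%R then
        if (job_length y <= job_length x)%R then job_id x <= job_id y else true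
      else false
    else true
  else false.

Definition klt (x y : job) : bool := ~~ kle y x.

Lemma kle_refl : reflexive kle.
Proof. by move=> x; rewrite /kle !lexx leqnn. Qed.

Lemma kle_total : total kle.
Proof.
move=> x y; rewrite /kle.
case: (ltgtP (job_start x) (job_start y)) => //= _.
by case: (ltgtP (job_length x) (job_length y)) => //= _; apply: leq_total.
Qed.

Lemma kle_anti : antisymmetric kle.
Proof.
move=> [[i s] l] [[i' s'] l']; rewrite /kle /job_start /job_length /job_id /=.
case: (ltgtP s s') => //= ->; case: (ltgtP l l') => //= ->.
by rewrite -eqn_leq => /eqP ->.
Qed.

Lemma kle_trans : transitive kle.
Proof.
move=> [[i' s'] l'] [[i s] l] [[i2 s2] l2].
rewrite /kle /job_start /job_length /job_id /=.
case: (ltgtP s s') => //= [lt1 _|->].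
  case: (ltgtP s' s2) => //= [lt2 _|<-]; last by rewrite (ltW lt1) [(s' <= s)%R]leNgt lt1.
  by have lt3 := lt_trans lt1 lt2; rewrite (ltW lt3) [(s2 <= s)%R]leNgt lt3.
case: (ltgtP s' s2) => //= _.
case: (ltgtP l l') => //= [lt1 _|->].
  case: (ltgtP l' l2) => //= [lt2 _|<-]; last by rewrite (ltW lt1) [(l' <= l)%R]leNgt lt1.
  by have lt3 := lt_trans lt1 lt2; rewrite (ltW lt3) [(l2 <= l)%R]leNgt lt3.
by case: (ltgtP l' l2) => //= _; apply: leq_trans.
Qed.

Lemma klt_irr : irreflexive klt.
Proof. by move=> x; rewrite /klt kle_refl. Qed.

Lemma kltW x y : klt x y -> kle x y.
Proof. by move=> /negbTE; have := kle_total x y; case: (kle y x); rewrite ?orbF. Qed.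

Lemma klt_le_trans y x z : klt x y -> kle y z -> klt x z.
Proof. by move=> xy yz; apply: contra xy; apply: kle_trans. Qed.

Lemma klt_trans : transitive klt.
Proof. by move=> y x z xy /kltW; apply: klt_le_trans. Qed.

Lemma klt_neqAle x y : klt x y = (x != y) && kle x y.
Proof.
apply/idP/andP => [xy|[ne le_xy]]; last first.
  by apply: contra ne => le_yx; apply/eqP/kle_anti/andP.
by split; [apply: contraTneq xy => ->; rewrite klt_irr | exact: kltW].
Qed.

Lemma klt_start x y : (job_start x < job_start y)%R -> klt x y.
Proof. by move=> lt_s; rewrite /klt /kle [(job_start y <= _)%R]leNgt lt_s. Qed.

Lemma kle_start x y : kle x y -> (job_start x <= job_start y)%R.
Proof. by rewrite /kle; case: ifP. Qed.

End KeyOrder.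

(** * Leaf-oriented AVL trees with minima of end times *)

Section Trees.
Variable R : realType.
Notation job := (job R).

(** One type serves the trees of jobs, machines and borders: the middle component is what the leaf
    contributes to the minimum of end times, and [None] hides the leaf from it. *)
Definition leaf := (job * option job * value R)%type.
Definition lkey (x : leaf) : job := x.1.1.
Definition lbest (x : leaf) : option job := x.1.2.
Definition lpay (x : leaf) : value R := x.2.

Inductive tree := Leaf of leaf | Node of tree & tree.

Fixpoint leaves (t : tree) : seq leaf :=
  match t with Leaf x => [:: x] | Node l r => leaves l ++ leaves r end.

Fixpoint hgt (t : tree) : nat :=
  match t with Leaf _ => 0 | Node l r => (maxn (hgt l) (hgt r)).+1 end.

Fixpoint mink (t : tree) : job :=
  match t with Leaf x => lkey x | Node l _ => mink l end.

Definition comb (a b : option job) : option job :=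
  match a, b with
  | Some x, Some y => if (job_end x <= job_end y)%R then a else b
  | None, _ => b
  | _, None => a
  end.

Fixpoint tbest (t : tree) : option job :=
  match t with Leaf x => lbest x | Node l r => comb (tbest l) (tbest r) end.

Fixpoint avl (t : tree) : bool :=
  match t with
  | Leaf _ => true
  | Node l r => [&& avl l, avl r, hgt l <= (hgt r).+1 & hgt r <= (hgt l).+1]
  end.

(** The single and double AVL rotations. A leaf never reaches the branches reserved for it, because
    it would have to be the strictly higher side. *)
Definition link (l r : tree) : tree :=
  if hgt l <= (hgt r).+1 then
    if hgt r <= (hgt l).+1 then Node l r else
    match r with
    | Node rl rr =>
        if hgt rl <= hgt rr then Node (Node l rl) rr else
        match rl with
        | Node a b => Node (Node l a) (Node b rr)
        | Leaf _ => Node l r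
        end
    | Leaf _ => Node l r
    end
  else
    match l with
    | Node ll lr =>
        if hgt lr <= hgt ll then Node ll (Node lr r) else
        match lr with
        | Node a b => Node (Node ll a) (Node b r)
        | Leaf _ => Node l r
        end
    | Leaf _ => Node l r
    end.

Definition olink (l r : option tree) : option tree :=
  match l, r with
  | Some l, Some r => Some (link l r)
  | None, _ => r
  | _, None => l
  end.

Fixpoint ins (t : tree) (x : leaf) : tree :=
  match t with
  | Leaf y =>
      if kle (lkey y) (lkey x) then
        if kle (lkey x) (lkey y) then Leaf x else Node t (Leaf x)
      else Node (Leaf x) t
  | Node l r =>
      if kle (mink r) (lkey x) then link l (ins r x) else link (ins l x) r
  end.

Definition oins (t : option tree) (x : leaf) : option tree :=
  Some (if t is Some t then ins t x else Leaf x).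

Fixpoint del (t : tree) (k : job) : option tree :=
  match t with
  | Leaf y => if kle (lkey y) k && kle k (lkey y) then None else Some t
  | Node l r =>
      if kle (mink r) k then olink (Some l) (del r k) else olink (del l k) (Some r)
  end.

Definition odel (t : option tree) (k : job) : option tree := obind (del^~ k) t.

Fixpoint pred (t : tree) (k : job) : option leaf :=
  match t with
  | Leaf y => if kle (lkey y) k then Some y else None
  | Node l r => if kle (mink r) k then pred r k else pred l k
  end.

Definition opred (t : option tree) (k : job) : option leaf := obind (pred^~ k) t.

Fixpoint best (t : tree) (k : job) : option job :=
  match t with
  | Leaf y => if kle k (lkey y) then lbest y else None
  | Node l r => if kle (mink r) k then best r k else comb (best l k) (tbest r)
  end.

Definition obest (t : option tree) (k : job) : option job := obind (best^~ k) t.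

Definition oleaves (t : option tree) : seq leaf := oapp leaves [::] t.
Definition oavl (t : option tree) : bool := oapp avl true t.
Definition ohgt (t : option tree) : nat := oapp hgt 0 t.

Lemma link_leaves l r : leaves (link l r) = leaves l ++ leaves r.
Proof.
rewrite /link; case: ifP => _.
  case: ifP => // _; case: r => //= rl rr; case: ifP => _ /=.
    by rewrite catA.
  by case: rl => //= a b; rewrite !catA.
case: l => //= ll lr; case: ifP => _ /=; first by rewrite catA.
by case: lr => //= a b; rewrite !catA.
Qed.

(** The first bounds leave the height uncertain by one. The last clause settles it when no rotation
    occurs, so that an insertion or deletion changes the height by at most one. *)
Lemma link_avl l r : avl l -> avl r -> hgt l <= (hgt r).+2 ->
  hgt r <= (hgt l).+2 ->
  [/\ avl (link l r), maxn (hgt l) (hgt r) <= hgt (link l r) &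
      hgt (link l r) <= (maxn (hgt l) (hgt r)).+1] /\
  (hgt l <= (hgt r).+1 -> hgt r <= (hgt l).+1 ->
   hgt (link l r) = (maxn (hgt l) (hgt r)).+1).
Proof.
rewrite /link; case: (leqP (hgt l) (hgt r).+1) => lt1.
  case: (leqP (hgt r) (hgt l).+1) => lt2.
    by move=> al ar _ _ /=; rewrite al ar lt1 lt2; split=> //; split=> //; lia.
  case: r lt1 lt2 => [x|rl rr] /=; first by lia.
  move=> lt1 lt2 al /and4P[arl arr h1 h2] h3 h4; case: (leqP (hgt rl) (hgt rr)) => lt3 /=.
    by rewrite al arl arr; split; [split|]; lia.
  case: rl lt1 lt2 arl h1 h2 h3 h4 lt3 => [x|a b] /=; first by lia.
  move=> lt1 lt2 /and4P[-> -> ? ?] ? ? ? ? ?; rewrite al arr.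
  by split; [split|]; lia.
case: l lt1 => [x|ll lr] /=; first by lia.
move=> lt1 /and4P[all alr h1 h2] ar h3 h4; case: (leqP (hgt lr) (hgt ll)) => lt3 /=.
  by rewrite ar all alr; split; [split|]; lia.
case: lr lt1 alr h1 h2 h3 h4 lt3 => [x|a b] /=; first by lia.
move=> lt1 /and4P[-> -> ? ?] ? ? ? ? ?; rewrite all ar.
by split; [split|]; lia.
Qed.

Lemma ins_avl t x : avl t ->
  [/\ avl (ins t x), hgt t <= hgt (ins t x) & hgt (ins t x) <= (hgt t).+1].
Proof.
elim: t => [y|l IHl r IHr] /=; first by do 2?case: ifP.
case/and4P=> /[dup] al /IHl[al' l1 l2] /[dup] ar /IHr[ar' r1 r2] h1 h2.
case: ifP => _.
  have [||[-> ? ?] H] := link_avl al ar'; try lia.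
  split=> //; last by lia.
  by move: H; case: (leqP (hgt l)); case: (leqP (hgt (ins r x))); lia.
have [||[-> ? ?] H] := link_avl al' ar; try lia.
split=> //; last by lia.
by move: H; case: (leqP (hgt (ins l x))); case: (leqP (hgt r)); lia.
Qed.

Lemma del_avl t k : avl t ->
  if del t k is Some t' then
    [/\ avl t', hgt t <= (hgt t').+1 & hgt t' <= hgt t]
  else hgt t = 0.
Proof.
elim: t => [y|l IHl r IHr] /=; first by case: ifP.
case/and4P=> /[dup] al /IHl {}IHl /[dup] ar /IHr {}IHr h1 h2.
case: ifP => _.
  case: (del r k) IHr => [r'|] /=; last by move=> Er; split=> //; lia.
  case=> ar' r1 r2; have [||[-> ? ?] H] := link_avl al ar'; try lia.
  split=> //; last by lia.
  by move: H; case: (leqP (hgt l)); case: (leqP (hgt r')); lia.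
case: (del l k) IHl => [l'|] /=; last by move=> Er; split=> //; lia.
case=> al' r1 r2; have [||[-> ? ?] H] := link_avl al' ar; try lia.
split=> //; last by lia.
by move: H; case: (leqP (hgt l')); case: (leqP (hgt r)); lia.
Qed.

(** Both subtrees of a node of height [h] have height at least [h - 2], so the number of leaves
    doubles every two levels. *)
Lemma avl_leaves t : avl t -> 2 ^ (hgt t)./2 <= size (leaves t).
Proof.
have [n] := ubnP (hgt t); elim: n t => // n IH [//|l r] /= lt_n.
case/and4P=> al ar h1 h2; rewrite size_cat.
have {}IH u : hgt u < n -> avl u -> (hgt u).+1 >= maxn (hgt l) (hgt r) ->
    2 ^ ((maxn (hgt l) (hgt r)).+1./2.-1) <= size (leaves u).
  move=> lt_u au le_u; apply: leq_trans (IH u _ au); last by lia.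
  by rewrite leq_exp2l //; lia.
have Hl : 2 ^ ((maxn (hgt l) (hgt r)).+1./2.-1) <= size (leaves l).
  by apply: IH => //; lia.
have Hr : 2 ^ ((maxn (hgt l) (hgt r)).+1./2.-1) <= size (leaves r).
  by apply: IH => //; lia.
rewrite uphalfE; case: ((maxn _ _).+1./2) Hl Hr => [|k]; rewrite ?expn0 ?expnS /=; lia.
Qed.

Definition lsorted (s : seq leaf) : bool := sorted (@klt R) (map lkey s).

Lemma lsorted_cat s1 s2 : lsorted (s1 ++ s2) ->
  [/\ lsorted s1, lsorted s2 &
      all (fun x => all (fun y => klt (lkey x) (lkey y)) s2) s1].
Proof.
rewrite /lsorted map_cat !(sorted_pairwise (@klt_trans R)) pairwise_cat.
case/and3P=> H -> ->; split=> //.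
by move: H; rewrite allrel_mapl allrel_mapr /allrel.
Qed.

Lemma minkE t : exists y s, leaves t = y :: s /\ mink t = lkey y.
Proof.
elim: t => [x|l [y [s [E1 E2]]] r _] /=; first by exists x, [::].
by exists y, (s ++ leaves r); rewrite E1.
Qed.


Lemma mink_le l r k : lsorted (leaves l ++ leaves r) -> kle (mink r) k ->
  all (fun y => klt (lkey y) k) (leaves l).
Proof.
move=> /lsorted_cat[_ _ H] le_k; apply: sub_all H => x.
have [y [s [-> E]]] := minkE r; rewrite /= => /andP[lt_y _].
by apply: klt_le_trans lt_y _; rewrite -E.
Qed.

Lemma mink_gt l r k : lsorted (leaves l ++ leaves r) -> ~~ kle (mink r) k ->
  all (fun y => klt k (lkey y)) (leaves r).
Proof.
move=> /lsorted_cat[_ Sr _] gt_k; have [y [s [Er E]]] := minkE r.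
move: Sr; rewrite Er /= E in gt_k * => Sr; rewrite /klt gt_k /=.
move: Sr; rewrite /lsorted /= (path_sortedE (@klt_trans R)) all_map => /andP[H _].
by apply: sub_all H => x /= lt_x; apply: (klt_trans gt_k lt_x).
Qed.

Lemma filter_all T (a : ssrbool.pred T) s : all a s -> filter a s = s.
Proof. by move/all_filterP. Qed.

Lemma filter_none T (a : ssrbool.pred T) s :
  all (fun x => ~~ a x) s -> filter a s = [::].
Proof. by elim: s => //= x s IH /andP[/negbTE-> /IH]. Qed.

Lemma klt_asym (x y : job) : klt x y -> ~~ klt y x.
Proof. by move=> /kltW le_xy; rewrite negbK. Qed.

Lemma ins_leaves t x : lsorted (leaves t) ->
  leaves (ins t x) =
  [seq y <- leaves t | klt (lkey y) (lkey x)] ++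
  x :: [seq y <- leaves t | klt (lkey x) (lkey y)].
Proof.
elim: t => [y|l IHl r IHr] /= S.
  by rewrite /klt; case: ifP => /= le_yx; [case: ifP|have /orP[->//|] := kle_total (lkey x) (lkey y); rewrite le_yx].
have [Sl Sr _] := lsorted_cat S.
case: ifPn => le_k; rewrite link_leaves !filter_cat ?IHl ?IHr //.
  have H := mink_le S le_k; rewrite (filter_all H) [X in _ :: X ++ _]filter_none ?catA //.
  by apply: sub_all H => y; apply: klt_asym.
have H := mink_gt S le_k.
have -> : [seq y <- leaves r | klt (lkey y) (lkey x)] = [::].
  by apply: filter_none; apply: sub_all H => y; apply: klt_asym.
by rewrite (filter_all H) cats0 -catA.
Qed.

Lemma olink_leaves l r : oleaves (olink l r) = oleaves l ++ oleaves r.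
Proof. by case: l r => [l|] [r|] //=; rewrite ?link_leaves ?cats0. Qed.

Lemma del_leaves t k : lsorted (leaves t) ->
  oleaves (del t k) = [seq y <- leaves t | lkey y != k].
Proof.
elim: t => [y|l IHl r IHr].
  move=> _ /=; case: ifPn => [/kle_anti->|]; rewrite ?eqxx //.
  by case: eqVneq => [->|//]; rewrite kle_refl.
have -> : del (Node l r) k = if kle (mink r) k
  then olink (Some l) (del r k) else olink (del l k) (Some r) by [].
move=> S.
have [Sl Sr _] := lsorted_cat S.
have N y z : klt y z -> y != z by rewrite klt_neqAle => /andP[].
case: ifPn => le_k; rewrite olink_leaves filter_cat ?IHl ?IHr //=.
  by congr (_ ++ _); rewrite filter_all //; apply: sub_all (mink_le S le_k) => y /N.
congr (_ ++ _); rewrite filter_all //; apply: sub_all (mink_gt S le_k) => y /N.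
by rewrite eq_sym.
Qed.

Lemma pred_leaves t k : lsorted (leaves t) ->
  pred t k = ohead (rev [seq y <- leaves t | kle (lkey y) k]).
Proof.
elim: t => [y|l IHl r IHr] /= S; first by case: ifP.
have [Sl Sr _] := lsorted_cat S.
case: ifPn => le_k; rewrite filter_cat rev_cat ?IHl ?IHr //.
  have [y [s [Er E]]] := minkE r; rewrite Er /= -E le_k rev_cons.
  by case: (rev _).
by rewrite [X in rev X ++ _]filter_none //; apply: mink_gt S le_k.
Qed.

Definition bestl (s : seq leaf) : option job := foldr comb None (map lbest s).

(** Ties always go to the left, so the cached minimum depends on the sequence of leaves and not on
    the shape of the tree. *)
Lemma combA : associative comb.
Proof.
move=> [x|] [y|] [z|] //=; last by case: ifP.
by case: (lerP (job_end y) (job_end z)) => yz;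
  case: (lerP (job_end x) (job_end y)) => xy //=;
  do 2?[case: lerP => //= ?]; exfalso; lra.
Qed.

Lemma bestl_cat s1 s2 : bestl (s1 ++ s2) = comb (bestl s1) (bestl s2).
Proof. by rewrite /bestl map_cat; elim: (map lbest s1) => //= b s ->; rewrite combA. Qed.

Lemma tbestE t : tbest t = bestl (leaves t).
Proof.
elim: t => [x|l IHl r IHr] /=; first by rewrite /bestl /=; case: (lbest x).
by rewrite bestl_cat IHl IHr.
Qed.

Lemma best_leaves t k : lsorted (leaves t) ->
  best t k = bestl [seq y <- leaves t | kle k (lkey y)].
Proof.
elim: t => [y|l IHl r IHr] /= S.
  by case: ifP => //= _; rewrite /bestl /=; case: (lbest y).
have [Sl Sr _] := lsorted_cat S.
case: ifPn => le_k; rewrite filter_cat bestl_cat ?IHl ?IHr ?tbestE //.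
  by rewrite [X in comb (bestl X)]filter_none //; apply: mink_le S le_k.
by rewrite [X in _ = comb _ (bestl X)]filter_all //; apply: sub_all (mink_gt S le_k) => y /kltW.
Qed.

Lemma bestlP s :
  if bestl s is Some b then
    (exists2 i, i < size s & nth None (map lbest s) i = Some b) /\
    (forall i c, i < size s -> nth None (map lbest s) i = Some c ->
      (job_end b <= job_end c)%R)
  else forall i, i < size s -> nth None (map lbest s) i = None.
Proof.
rewrite /bestl -(size_map lbest); elim: (map lbest s) => //= o {}s IH.
case: o IH => [x|] /=; case: (foldr comb None s) => [b|] /=.
- case=> [[i lt_i Ei] H]; case: lerP => xb; split.
  + by exists 0.
  + case=> [|j] c /=; first by move=> _ [->].
    by move=> lt_j Ej; apply: le_trans xb (H j c lt_j Ej).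
  + by exists i.+1.
  + case=> [|j] c /=; first by move=> _ [<-]; apply: ltW.
    exact: H.
- move=> H; split; first by exists 0.
  by case=> [|j] c /=; [move=> _ [->] | move=> /H ->].
- case=> [[i lt_i Ei] H]; split; first by exists i.+1.
  by case=> [|j] c //=; apply: H.
- by move=> H [|j] //=; apply: H.
Qed.

(** The contents are a function [f] of the key, so that rescheduling a job changes [f] at one point
    and leaves the list of keys alone. *)
Definition trep (f : job -> leaf) (ks : seq job) (t : option tree) : Prop :=
  [/\ oavl t, sorted (@klt R) ks & oleaves t = map f ks].

Definition insk (k : job) (ks : seq job) : seq job :=
  [seq y <- ks | klt y k] ++ k :: [seq y <- ks | klt k y].

Lemma mem_insk k ks : insk k ks =i k :: ks.
Proof.
move=> y; rewrite mem_cat !inE !mem_filter.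
case: eqVneq => [->|ne] /=; first by rewrite !orbT.
rewrite -andb_orl !klt_neqAle ne eq_sym ne /=.
by rewrite kle_total.
Qed.

Lemma insk_sorted k ks : sorted (@klt R) ks -> sorted (@klt R) (insk k ks).
Proof.
rewrite !(sorted_pairwise (@klt_trans R)) => S.
rewrite pairwise_cat /= !pairwise_filter // andbT; apply/and3P; split=> //.
  apply/allrelP => x y; rewrite !inE !mem_filter => /andP[lt_x _].
  by case/predU1P=> [->//|/andP[lt_y _]]; apply: klt_trans lt_x lt_y.
by apply/allP => x; rewrite mem_filter => /andP[].
Qed.

Lemma insk_id k ks : sorted (@klt R) ks -> k \in ks -> insk k ks = ks.
Proof.
move=> S kin; apply: (irr_sorted_eq (@klt_trans R) (@klt_irr R)) => //.
  exact: insk_sorted.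
by move=> y; rewrite mem_insk inE; case: eqVneq => // ->.
Qed.

Lemma klt_sorted_uniq ks : sorted (@klt R) ks -> uniq ks.
Proof. exact: (sorted_uniq (@klt_trans R) (@klt_irr R)). Qed.

Section Rep.
Variables (f : job -> leaf) (ks : seq job) (t : option tree).
Hypothesis fK : forall k, lkey (f k) = k.
Hypothesis rep : trep f ks t.

Lemma trep_lsorted : lsorted (oleaves t).
Proof.
by case: rep => _ S ->; rewrite /lsorted -map_comp (eq_map (g := id)) ?map_id.
Qed.

(** Covers new keys and overwriting at once: [f'] is free at [k], and [insk] does not change a
    sorted list that already contains [k]. *)
Lemma trep_ins f' k : (forall y, lkey (f' y) = y) ->
  (forall y, y \in ks -> y != k -> f' y = f y) ->
  trep f' (insk k ks) (oins t (f' k)).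
Proof.
move=> fK' ff'; have S := trep_lsorted; case: rep => A Sk E.
split; last 1 first.
- have -> : oleaves (oins t (f' k)) = [seq y <- oleaves t | klt (lkey y) k] ++
      f' k :: [seq y <- oleaves t | klt k (lkey y)].
    by case: (t) S => //= t0 S; rewrite ins_leaves // fK'.
  rewrite E /insk map_cat /= !filter_map; congr (_ ++ _ :: _).
    have -> : [seq y <- ks | klt y k] = [seq y <- ks | preim f (fun y => klt (lkey y) k) y].
      by apply: eq_filter => y; rewrite /= fK.
    apply/eq_in_map => y; rewrite mem_filter /= fK klt_neqAle => /andP[/andP[ne _] yin].
    by rewrite ff'.
  have -> : [seq y <- ks | klt k y] = [seq y <- ks | preim f (fun y => klt k (lkey y)) y].
    by apply: eq_filter => y; rewrite /= fK.
  apply/eq_in_map => y; rewrite mem_filter /= fK klt_neqAle eq_sym => /andP[/andP[ne _] yin].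
  by rewrite ff'.
- by case: (t) A => //= t0 At; case: (ins_avl (f' k) At).
- exact: insk_sorted.
Qed.

Lemma trep_del k : trep f [seq y <- ks | y != k] (odel t k).
Proof.
have S := trep_lsorted; case: rep => A Sk E; split.
- by case: (t) A => //= t0 At; have := del_avl k At; case: (del t0 k) => // t' [].
- exact: (sorted_filter (@klt_trans R)).
have -> : oleaves (odel t k) = [seq y <- oleaves t | lkey y != k].
  by case: (t) S => //= t0 S; rewrite del_leaves.
by rewrite E filter_map; congr map; apply: eq_filter => y /=; rewrite fK.
Qed.

Lemma trep_pred k :
  if opred t k is Some x then
    exists y, [/\ x = f y, y \in ks, kle y k &
                  forall z, z \in ks -> kle z k -> kle z y]
  else forall y, y \in ks -> klt k y.
Proof.
have S := trep_lsorted; case: rep => A Sk E.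
have -> : opred t k = ohead (rev [seq y <- oleaves t | kle (lkey y) k]).
  by case: (t) S => //= t0 S; rewrite pred_leaves.
rewrite E filter_map -map_rev.
have -> : [seq y <- ks | preim f (fun y => kle (lkey y) k) y] = [seq y <- ks | kle y k].
  by apply: eq_filter => y /=; rewrite fK.
case Er: (rev _) => [|y s] /=.
  move=> y yin; rewrite /klt; apply/negP => le_y.
  have: y \in rev [seq y <- ks | kle y k] by rewrite mem_rev mem_filter le_y.
  by rewrite Er.
have Ey : [seq y <- ks | kle y k] = rcons (rev s) y by rewrite -[LHS]revK Er rev_cons.
have /andP[le_y yin] : (kle y k) && (y \in ks).
  by rewrite -(mem_filter (fun z => kle z k)) Ey mem_rcons inE eqxx.
exists y; split=> // z zin le_z.
have: z \in rcons (rev s) y by rewrite -Ey mem_filter le_z.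
rewrite mem_rcons inE => /predU1P[->|zs]; first exact: kle_refl.
have: sorted (@klt R) (rcons (rev s) y).
  by rewrite -Ey; apply: (sorted_filter (@klt_trans R)).
rewrite (sorted_pairwise (@klt_trans R)) pairwise_rcons => /andP[/allP/(_ z zs)].
by move=> /kltW.
Qed.

Lemma trep_best k :
  if obest t k is Some b then
    (exists y, [/\ y \in ks, kle k y & lbest (f y) = Some b]) /\
    (forall y c, y \in ks -> kle k y -> lbest (f y) = Some c ->
      (job_end b <= job_end c)%R)
  else forall y, y \in ks -> kle k y -> lbest (f y) = None.
Proof.
have S := trep_lsorted; case: rep => A Sk E.
have -> : obest t k = bestl [seq y <- oleaves t | kle k (lkey y)].
  by case: (t) S => //= t0 S; rewrite best_leaves.
rewrite E filter_map.
have -> : [seq y <- ks | preim f (fun y => kle k (lkey y)) y] = [seq y <- ks | kle k y].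
  by apply: eq_filter => y /=; rewrite fK.
set s := [seq y <- ks | kle k y]; have := bestlP (map f s).
have H y : y \in ks -> kle k y -> exists2 i, i < size (map f s) &
    nth None (map lbest (map f s)) i = lbest (f y).
  move=> yin le_y; have ys : y \in s by rewrite mem_filter le_y.
  exists (index y s); first by rewrite size_map index_mem.
  by rewrite (nth_map (f y)) ?size_map ?index_mem // (nth_map y) ?index_mem // nth_index.
case: (bestl _) => [b [[i lt_i Ei] Hb]|Hb].
  split; last by move=> y c yin le_y Ey; have [j lt_j Ej] := H y yin le_y;
    apply: Hb lt_j _; rewrite Ej.
  rewrite size_map in lt_i; case: s lt_i Ei {H Hb} ((fun x => mem_filter (fun z => kle k z) x ks) : forall x, (x \in s) = _) => // y0 s0 lt_i Ei Hs.
  exists (nth y0 (y0 :: s0) i).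
  have := mem_nth y0 lt_i; rewrite Hs => /andP[le_y yin]; split=> //.
  by rewrite -Ei (nth_map (f y0)) ?size_map // (nth_map y0).
by move=> y yin le_y; have [j lt_j <-] := H y yin le_y; apply: Hb.
Qed.

Lemma trep_hgt : 2 ^ (ohgt t)./2 <= (size ks).+1.
Proof.
case: rep => A _ E; rewrite -(size_map f) -E; case: (t) A => //= t0 /avl_leaves.
exact: leqW.
Qed.

End Rep.
End Trees.

(** * The program *)

Section Code.
Local Notation "'π1' e" := (Op1 Fst e) (at level 9, e at level 9).
Local Notation "'π2' e" := (Op1 Snd e) (at level 9, e at level 9).
Local Notation "⟨ x , .. , y , z ⟩" := (Op2 MkPair x .. (Op2 MkPair y z) ..).
Local Notation null := (Op1 IsNull).
Local Notation arg := (Var 0).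

Local Notation Id k := (π1 k).
Local Notation St k := (π1 (π2 k)).
Local Notation Ln k := (π2 (π2 k)).
Local Notation End k := (Op2 RealAdd (St k) (Ln k)).

(* A tree is a pair (header, body). The header is (least key, height, earliest
   ending candidate or null); the body is the payload of a leaf, which has
   height 0, or the pair of the subtrees. *)
Local Notation Key t := (π1 (π1 t)).
Local Notation Hgt t := (π1 (π2 (π1 t))).
Local Notation Bst t := (π2 (π2 (π1 t))).
Local Notation Lft t := (π1 (π2 t)).
Local Notation Rgt t := (π2 (π2 t)).
Local Notation IsLeaf t := (Op2 NatLe (Hgt t) (NatLit 0)).
Local Notation MkLeaf k b p := (⟨⟨k, NatLit 0, b⟩, p⟩).
Local Notation Real0 := (Op1 RealOfNat (NatLit 0)).
Local Notation Succ e := (Op2 NatAdd e (NatLit 1)).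

Definition fKLE := 0.
Definition fCOMB := 1.
Definition fMK := 2.
Definition fLINK := 3.
Definition fINS := 4.
Definition fDEL := 5.
Definition fPRED := 6.
Definition fBEST := 7.
Definition fCLEAR := 8.
Definition fGREEDY := 9.
Definition fSOLVE := 10.
Definition fMERGE := 11.
Definition fUPD := 12.

Definition KLE : expr :=
  let x := π1 arg in let y := π2 arg in
  If (Op2 RealLe (St x) (St y))
    (If (Op2 RealLe (St y) (St x))
      (If (Op2 RealLe (Ln x) (Ln y))
        (If (Op2 RealLe (Ln y) (Ln x)) (Op2 NatLe (Id x) (Id y)) (NatLit 1))
        (NatLit 0))
      (NatLit 1))
    (NatLit 0).

Definition COMB : expr :=
  let x := π1 arg in let y := π2 arg in
  If (null x) y (If (null y) x (If (Op2 RealLe (End x) (End y)) x y)).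

Definition MK : expr :=
  let l := π1 arg in let r := π2 arg in
  ⟨⟨Key l,
    Succ (If (Op2 NatLe (Hgt l) (Hgt r)) (Hgt r) (Hgt l)),
    Call fCOMB ⟨Bst l, Bst r⟩⟩,
   arg⟩.

(** Null arguments are accepted because a deletion may empty one side; the same function thus
    computes [olink]. *)
Definition LINK : expr :=
  let l := π1 arg in let r := π2 arg in
  let mk x y := Call fMK ⟨x, y⟩ in
  If (null l) r (If (null r) l
  (If (Op2 NatLe (Hgt l) (Succ (Hgt r)))
    (If (Op2 NatLe (Hgt r) (Succ (Hgt l))) (Call fMK arg)
      (If (Op2 NatLe (Hgt (Lft r)) (Hgt (Rgt r)))
        (mk (mk l (Lft r)) (Rgt r))
        (mk (mk l (Lft (Lft r))) (mk (Rgt (Lft r)) (Rgt r)))))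
    (If (Op2 NatLe (Hgt (Rgt l)) (Hgt (Lft l)))
      (mk (Lft l) (mk (Rgt l) r))
      (mk (mk (Lft l) (Lft (Rgt l))) (mk (Rgt (Rgt l)) r))))).

Definition INS : expr :=
  let t := π1 arg in let x := π2 arg in
  If (null t) x
  (If (IsLeaf t)
    (If (Call fKLE ⟨Key t, Key x⟩)
      (If (Call fKLE ⟨Key x, Key t⟩) x (Call fMK ⟨t, x⟩))
      (Call fMK ⟨x, t⟩))
    (If (Call fKLE ⟨Key (Rgt t), Key x⟩)
      (Call fLINK ⟨Lft t, Call fINS ⟨Rgt t, x⟩⟩)
      (Call fLINK ⟨Call fINS ⟨Lft t, x⟩, Rgt t⟩))).

Definition DEL : expr :=
  let t := π1 arg in let k := π2 arg in
  If (null t) NullLit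
  (If (IsLeaf t)
    (If (Call fKLE ⟨Key t, k⟩) (If (Call fKLE ⟨k, Key t⟩) NullLit t) t)
    (If (Call fKLE ⟨Key (Rgt t), k⟩)
      (Call fLINK ⟨Lft t, Call fDEL ⟨Rgt t, k⟩⟩)
      (Call fLINK ⟨Call fDEL ⟨Lft t, k⟩, Rgt t⟩))).

Definition PRED : expr :=
  let t := π1 arg in let k := π2 arg in
  If (null t) NullLit
  (If (IsLeaf t)
    (If (Call fKLE ⟨Key t, k⟩) t NullLit)
    (If (Call fKLE ⟨Key (Rgt t), k⟩)
      (Call fPRED ⟨Rgt t, k⟩) (Call fPRED ⟨Lft t, k⟩))).

Definition BEST : expr :=
  let t := π1 arg in let k := π2 arg in
  If (null t) NullLit
  (If (IsLeaf t)
    (If (Call fKLE ⟨k, Key t⟩) (Bst t) NullLit)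
    (If (Call fKLE ⟨Key (Rgt t), k⟩)
      (Call fBEST ⟨Rgt t, k⟩)
      (Call fCOMB ⟨Call fBEST ⟨Lft t, k⟩, Bst (Rgt t)⟩))).

(* Argument: (job tree, list of jobs to unschedule). *)
Definition CLEAR : expr :=
  let t := π1 arg in let s := π2 arg in
  If (null s) t
  (Call fCLEAR ⟨Call fINS ⟨t, MkLeaf (π1 s) (π1 s) (NatLit 0)⟩, π2 s⟩).

(* Argument: ((left border, right border or null, cap), job tree, tree of the
   opened machines, number of unopened machines, number of jobs scheduled so
   far, their list). Result: (job tree, (number, list), new border or null). *)
Definition GREEDY : expr :=
  let C i := π1 (Var i) in let S i := π2 (Var i) in
  let ka i := π1 (C i) in let b i := π1 (π2 (C i)) in let cap i := π2 (π2 (C i)) in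
  let t i := π1 (S i) in let mt i := π1 (π2 (S i)) in
  let u i := π1 (π2 (π2 (S i))) in let cl i := π2 (π2 (π2 (S i))) in
  let c i := π1 (cl i) in let s i := π2 (cl i) in
  let mleaf i e := MkLeaf ⟨i, e, Real0⟩ ⟨i, e, Real0⟩ NullLit in
  Let (If (Op2 NatLe (NatLit 1) (u 0)) (ka 0) (Call fBEST ⟨mt 0, ka 0⟩))
  (Let (Call fBEST ⟨t 1, Var 0⟩)
  (If (null (Var 0)) ⟨t 2, cl 2, NullLit⟩
  (If (If (null (b 2)) (NatLit 0) (Op2 RealLe (St (b 2)) (End (Var 0))))
    ⟨t 2, cl 2, NullLit⟩
  (If (Op2 RealLe (cap 2) (Op1 RealOfNat (c 2)))
    ⟨t 2, cl 2, NatLit 0, End (Var 0), Real0⟩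
  (Let (Call fPRED ⟨mt 2, Var 0⟩)
  (If (null (Var 0))
    (Call fGREEDY ⟨C 3,
       Call fINS ⟨t 3, MkLeaf (Var 1) NullLit (u 3)⟩,
       Call fINS ⟨mt 3, mleaf (Op2 NatSub (u 3) (NatLit 1)) (End (Var 1))⟩,
       Op2 NatSub (u 3) (NatLit 1), Succ (c 3), Var 1, s 3⟩)
    (Call fGREEDY ⟨C 3,
       Call fINS ⟨t 3, MkLeaf (Var 1) NullLit (Succ (Id (Key (Var 0))))⟩,
       Call fINS ⟨Call fDEL ⟨mt 3, Key (Var 0)⟩,
                  mleaf (Id (Key (Var 0))) (End (Var 1))⟩,
       u 3, Succ (c 3), Var 1, s 3⟩))))))).

(* Argument: (parameters, left border, right border or null, job tree, border
   tree), where the parameters are (M, T, U). Result: (job tree, border tree). *)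
Definition SOLVE : expr :=
  let par i := π1 (Var i) in let ka i := π1 (π2 (Var i)) in
  let b i := π1 (π2 (π2 (Var i))) in let t i := π1 (π2 (π2 (π2 (Var i)))) in
  let bt i := π2 (π2 (π2 (π2 (Var i)))) in
  Let (Call fGREEDY ⟨⟨ka 0, b 0, π2 (π2 (par 0))⟩,
         t 0, NullLit, π1 (par 0), NatLit 0, NullLit⟩)
  (Let (Call fINS ⟨bt 1, MkLeaf (ka 1) (ka 1) (π1 (π2 (Var 0)))⟩)
  (If (null (π2 (π2 (Var 1)))) ⟨π1 (Var 1), Var 0⟩
    (Call fSOLVE ⟨par 2, π2 (π2 (Var 1)), b 2, π1 (Var 1), Var 0⟩))).

(* Argument: (parameters, border, job tree, border tree). *)
Definition MERGE : expr :=
  let par i := π1 (Var i) in let kb i := π1 (π2 (Var i)) in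
  let st i := π2 (π2 (Var i)) in
  let t i := π1 (st i) in let bt i := π2 (st i) in
  Let (Call fPRED ⟨bt 0, NatLit 0, St (kb 0), Op2 RealSub Real0 (Op1 RealOfNat (NatLit 1))⟩)
  (If (null (Var 0)) (st 1)
  (Let (Call fPRED ⟨bt 1, kb 1⟩)
  (If (Op2 RealLe (π1 (π2 (par 2)))
        (Op1 RealOfNat (Op2 NatAdd (π1 (π2 (Var 1))) (π1 (π2 (Var 0))))))
    (st 2)
  (Let (Call fCLEAR ⟨Call fCLEAR ⟨t 2, π2 (π2 (Var 1))⟩, π2 (π2 (Var 0))⟩)
  (Let (Call fDEL ⟨bt 3, kb 3⟩)
  (Call fSOLVE ⟨par 4, Key (Var 3),
     Call fBEST ⟨Var 0, NatLit 1, St (kb 4), Real0⟩, Var 1, Var 0⟩)))))).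

(* Argument: (root, job, M, eps, flag), where the flag tells an insertion from
   a deletion; the root is null before the first update. *)
Definition UPD : expr :=
  let j i := π1 (π2 (Var i)) in let M i := π1 (π2 (π2 (Var i))) in
  let eps i := π1 (π2 (π2 (π2 (Var i)))) in
  let flag i := π2 (π2 (π2 (π2 (Var i)))) in
  let k0 := ⟨NatLit 0, Real0, Real0⟩ in
  let T i := Op2 RealAdd
    (Op2 RealDiv (Op1 RealOfNat (Op2 NatAdd (M i) (M i))) (eps i))
    (Op1 RealOfNat (NatLit 2)) in
  Let (If (null (π1 (Var 0))) ⟨NullLit, MkLeaf k0 k0 ⟨NatLit 0, NullLit⟩⟩ (π1 (Var 0)))
  (Let ⟨M 1, T 1, Op2 RealAdd (T 1) (Op1 RealOfNat (M 1))⟩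
  (Let (Call fPRED ⟨π2 (Var 1), j 2⟩)
  (Let (Call fCLEAR ⟨π1 (Var 2), π2 (π2 (Var 0))⟩)
  (Let (If (flag 4) (Call fINS ⟨Var 0, MkLeaf (j 4) (j 4) (NatLit 0)⟩)
                    (Call fDEL ⟨Var 0, j 4⟩))
  (Let (Call fBEST ⟨π2 (Var 4), NatLit 1, St (Key (Var 2)), Real0⟩)
  (Let (Call fSOLVE ⟨Var 4, Key (Var 3), Var 0, Var 1, π2 (Var 5)⟩)
  (Let (If (null (Var 1)) (Var 0) (Call fMERGE ⟨Var 5, Var 1, Var 0⟩))
  (Call fMERGE ⟨Var 6, Key (Var 5), Var 0⟩)))))))).

Definition prog : program :=
  [:: KLE; COMB; MK; LINK; INS; DEL; PRED; BEST; CLEAR; GREEDY; SOLVE; MERGE; UPD].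

(** Cell 0 is the only one in use: it holds the root, and an update replaces it by the root of the
    new immutable trees. *)
Definition update_code (flag : nat) : expr :=
  Store (NatLit 0)
    (Call fUPD ⟨Fetch (NatLit 0), Var 0, Var 1, Var 2, NatLit flag⟩).

Definition scheduler : algorithm :=
  Algorithm prog (update_code 1) (update_code 0)
    (π2 (Call fPRED ⟨π1 (Fetch (NatLit 0)), Var 0⟩)).

End Code.

(** * Encoding of trees and lists as words *)

Section Encoding.
Variable R : realType.
Notation job := (job R).
Notation tree := (tree R).
Notation leaf := (leaf R).
Notation value := (value R).

Definition eopt (o : option job) : value :=
  if o is Some j then job_word j else VNull R.

Definition ehead (t : tree) : value :=
  VPair (job_word (mink t)) (VPair (VNat R (hgt t)) (eopt (tbest t))).

Fixpoint ebody (t : tree) : value :=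
  match t with
  | Leaf x => lpay x
  | Node l r => VPair (VPair (ehead l) (ebody l)) (VPair (ehead r) (ebody r))
  end.

Definition etree (t : tree) : value := VPair (ehead t) (ebody t).

Definition otree (t : option tree) : value := oapp etree (VNull R) t.

Definition eleaf (x : leaf) : value := etree (Leaf x).

Definition oleaf (x : option leaf) : value := oapp eleaf (VNull R) x.

Definition elist (s : seq job) : value :=
  foldr (fun j v => VPair (job_word j) v) (VNull R) s.

End Encoding.

Ltac ev := cbn [wp onth eval_op1 eval_op2 job_word ehead etree otree oleaf eleaf
  oapp vbool hgt mink tbest ebody eopt elist foldr
  nth prog fKLE fCOMB fMK fLINK fINS fDEL fPRED fBEST fCLEAR fGREEDY fSOLVE fMERGE fUPD
  KLE COMB MK LINK INS DEL PRED BEST CLEAR GREEDY SOLVE MERGE UPD].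
Ltac evcall L := do 2 eexists; split; [exact: L|]; ev.

(** * Correctness and cost of the tree functions *)

Section TreeCode.
Variable R : realType.
Notation call := (pcall (R := R) prog).

Lemma call_kle x y :
  call fKLE (VPair (job_word x) (job_word y)) (vbool R (kle x y)) 1.
Proof.
apply: pcall_body => //; rewrite /kle; ev.
case: (_ <= _)%R => //=; case: (_ <= _)%R => //=.
by case: (_ <= _)%R => //=; case: (_ <= _)%R.
Qed.

Lemma call_comb a b : call fCOMB (VPair (eopt a) (eopt b)) (eopt (comb a b)) 1.
Proof.
apply: pcall_body => //; case: a b => [a|] [b|]; ev => //.
rewrite /= -/(job_end a) -/(job_end b); by case: (_ <= _)%R.
Qed.

Lemma call_mk l r : call fMK (VPair (etree l) (etree r)) (etree (Node l r)) 2.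
Proof.
apply: pcall_body => //; ev; rewrite -/(job_word _).
have -> : etree (Node l r) = VPair (VPair (job_word (mink l))
    (VPair (VNat R (maxn (hgt l) (hgt r)).+1) (eopt (comb (tbest l) (tbest r)))))
    (VPair (etree l) (etree r)) by [].
case: leqP => h; ev; rewrite -?/(job_word _); evcall call_comb;
  by rewrite addn1; split=> //; lia.
Qed.

Lemma call_link l r : avl l -> avl r ->
  call fLINK (VPair (etree l) (etree r)) (etree (link l r)) 7.
Proof.
move=> al ar; apply: pcall_body => //; rewrite /link; ev; rewrite !addn1.
case: (leqP (hgt l) (hgt r).+1) => h1; ev.
  case: (leqP (hgt r) (hgt l).+1) => h2; ev; first by evcall (call_mk l r).
  case: r ar h1 h2 => [x|rl rr] /=; first by lia.
  case/and4P=> arl arr _ _ h1 h2; ev; case: (leqP (hgt rl) (hgt rr)) => h3; ev.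
    by evcall (call_mk l rl); evcall (call_mk (Node l rl) rr).
  case: rl arl h1 h2 h3 => [x|a b] /=; first by lia.
  move=> _ _ _ _; ev; evcall (call_mk l a); evcall (call_mk b rr).
  by evcall (call_mk (Node l a) (Node b rr)).
case: l al h1 => [x|ll lr] /=; first by lia.
case/and4P=> all alr _ _ h1; ev; case: (leqP (hgt lr) (hgt ll)) => h3; ev.
  by evcall (call_mk lr r); evcall (call_mk ll (Node lr r)).
case: lr alr h1 h3 => [x|a b] /=; first by lia.
move=> _ _ _; ev; evcall (call_mk ll a); evcall (call_mk b r).
by evcall (call_mk (Node ll a) (Node b r)).
Qed.

Lemma call_olink l r : oavl l -> oavl r ->
  call fLINK (VPair (otree l) (otree r)) (otree (olink l r)) 7.
Proof.
case: l r => [l|] [r|] /=; first exact: call_link;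
  by move=> _ _; apply: pcall_body => //; ev.
Qed.

(** Each level costs one comparison (1), one [LINK] (7) and its own body; the factor 10 is shared by
    all tree functions so that a single bound covers them. *)
Lemma call_ins t x : avl t ->
  call fINS (VPair (etree t) (eleaf x)) (etree (ins t x)) (10 * (hgt t).+1).
Proof.
elim: t => [y|l IHl r IHr] /=.
  move=> _; apply: pcall_body => //; ev.
  evcall call_kle; case: (kle _ _); ev; last by evcall (call_mk (Leaf x) (Leaf y)).
  evcall call_kle; case: (kle _ _); ev => //.
  by evcall (call_mk (Leaf y) (Leaf x)).
case/and4P=> /[dup] al /IHl {}IHl /[dup] ar /IHr {}IHr h1 h2.
apply: pcall_body => //; ev; evcall call_kle; case: (kle _ _); ev.
  evcall IHr; case: (ins_avl x ar) => ar' _ _; evcall (call_link al ar').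
  by split=> //; lia.
evcall IHl; case: (ins_avl x al) => al' _ _; evcall (call_link al' ar).
by split=> //; lia.
Qed.

Lemma call_oins t x : oavl t ->
  call fINS (VPair (otree t) (eleaf x)) (otree (oins t x)) (10 * (ohgt t).+1).
Proof. by case: t => [t|] /=; [exact: call_ins | move=> _; apply: pcall_body]. Qed.

Lemma call_del t k : avl t ->
  call fDEL (VPair (etree t) (job_word k)) (otree (del t k)) (10 * (hgt t).+1).
Proof.
elim: t => [y|l IHl r IHr].
  move=> _; apply: pcall_body => //; ev.
  evcall call_kle; rewrite /=; case: (kle _ _); ev => //.
  by evcall call_kle; case: (kle _ _).
have -> : del (Node l r) k = if kle (mink r) k
  then olink (Some l) (del r k) else olink (del l k) (Some r) by [].
case/and4P=> /[dup] al /IHl {}IHl /[dup] ar /IHr {}IHr h1 h2.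
apply: pcall_body => //; ev; evcall call_kle; case: (kle _ _); ev.
  evcall IHr; have ar' : oavl (del r k).
    by have := del_avl k ar; case: (del r k) => // r' [].
  by evcall (call_olink (al : oavl (Some l)) ar'); split=> //; lia.
evcall IHl; have al' : oavl (del l k).
  by have := del_avl k al; case: (del l k) => // r' [].
by evcall (call_olink al' (ar : oavl (Some r))); split=> //; lia.
Qed.

Lemma call_odel t k : oavl t ->
  call fDEL (VPair (otree t) (job_word k)) (otree (odel t k)) (10 * (ohgt t).+1).
Proof. by case: t => [t|] /=; [exact: call_del | move=> _; apply: pcall_body]. Qed.

Lemma call_pred t k :
  call fPRED (VPair (etree t) (job_word k)) (oleaf (pred t k)) (10 * (hgt t).+1).
Proof.
elim: t => [y|l IHl r IHr] /=; apply: pcall_body => //; ev.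
  by evcall call_kle; case: (kle _ _); ev.
evcall call_kle; case: (kle _ _); ev; [evcall IHr | evcall IHl]; by split=> //; lia.
Qed.

Lemma call_opred t k :
  call fPRED (VPair (otree t) (job_word k)) (oleaf (opred t k)) (10 * (ohgt t).+1).
Proof. by case: t => [t|] /=; [exact: call_pred | apply: pcall_body]. Qed.

Lemma call_best t k :
  call fBEST (VPair (etree t) (job_word k)) (eopt (best t k)) (10 * (hgt t).+1).
Proof.
elim: t => [y|l IHl r IHr] /=; apply: pcall_body => //; ev.
  by evcall call_kle; case: (kle _ _); ev.
evcall call_kle; case: (kle _ _); ev; first by evcall IHr; split=> //; lia.
by evcall IHl; evcall call_comb; split=> //; lia.
Qed.

Lemma call_obest t k :
  call fBEST (VPair (otree t) (job_word k)) (eopt (obest t k)) (10 * (ohgt t).+1).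
Proof. by case: t => [t|] /=; [exact: call_best | apply: pcall_body]. Qed.

End TreeCode.

(** * Schedules and regions *)

Section Schedules.
Variable R : realType.
Notation job := (job R).
Local Open Scope ring_scope.

(** Competitors are lists with a machine function, which can be filtered and exchanged without
    dependence on a set of jobs. *)
Definition sched (M : nat) (S : seq job) (g : job -> nat) : Prop :=
  [/\ uniq S, forall x, x \in S -> (g x < M)%N &
      forall x y, x \in S -> y \in S -> x != y -> g x = g y -> ~~ overlap x y].

Lemma sched_filter M S g p : sched M S g -> sched M (filter p S) g.
Proof.
case=> U lt_g no; split; first exact: filter_uniq.
  by move=> x; rewrite mem_filter => /andP[_]; apply: lt_g.
by move=> x y; rewrite !mem_filter => /andP[_ xS] /andP[_ yS]; apply: no.
Qed.

(** Pairwise overlapping jobs occupy distinct machines. *)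
Lemma sched_size M S g : sched M S g ->
  (forall x y, x \in S -> y \in S -> overlap x y) -> (size S <= M)%N.
Proof.
case=> U lt_g no ov; rewrite -(size_map g) -[leqRHS](size_iota 0).
apply: uniq_leq_size.
  rewrite map_inj_in_uniq // => x y xS yS Eg; apply/eqP.
  by apply: contraT => ne; have := no x y xS yS ne Eg; rewrite ov.
by move=> _ /mapP[x xS ->]; rewrite mem_iota lt_g.
Qed.

Lemma sched_crossing M S g b : sched M S g ->
  (forall x, x \in S -> job_start x < b <= job_end x) -> (size S <= M)%N.
Proof.
move=> sS H; apply: (sched_size sS) => x y /H/andP[x1 x2] /H/andP[y1 y2].
by rewrite /overlap (lt_le_trans x1 y2) (lt_le_trans y1 x2).
Qed.

Definition fits (F : nat -> R) (S : seq job) (g : job -> nat) : Prop :=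
  forall x, x \in S -> F (g x) <= job_start x.

Definition set_at T (F : nat -> T) (i : nat) (v : T) : nat -> T :=
  fun k => if k == i then v else F k.

(* If the job [j] ends first among the competitors, then putting it on the
   best-fitting machine [i] costs at most one job of any schedule: after
   exchanging the contents of [i] and of the machine that holds [j], all jobs
   on [i] but one start after the end of [j]. *)
Lemma best_fit_exchange M F S g j i : sched M S g -> fits F S g ->
  job_start j < job_end j -> (i < M)%N -> F i <= job_start j ->
  (forall k, (k < M)%N -> F k <= job_start j -> F k <= F i) ->
  (forall x, x \in S -> job_end j <= job_end x) ->
  exists S' g', [/\ sched M S' g', fits (set_at F i (job_end j)) S' g',
    {subset S' <= S}, j \notin S' & (size S <= (size S').+1)%N].
Proof.
move=> sS fS lt_j lt_i fit_j best_i end_j.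
suff [g' [sS' fS' gj]] : exists g', [/\ sched M S g', fits F S g' &
    j \in S -> g' j = i].
  pose late x := ~~ ((g' x == i) && (job_start x < job_end j)).
  have Sl := sched_filter late sS'.
  exists (filter late S), g'; split=> //.
  - move=> x; rewrite mem_filter /late => /andP[lx xS]; rewrite /set_at.
    case: eqVneq lx => [_ /=|_ _]; last exact: fS'.
    by rewrite -leNgt.
  - by move=> x; rewrite mem_filter => /andP[].
  - by rewrite mem_filter /late; apply/negP => /andP[H /gj Eg]; move: H; rewrite Eg eqxx lt_j.
  rewrite -(count_predC late) size_filter -addn1 leq_add2l -size_filter.
  (* The discarded jobs all sit on [i], start before the end of [j] and end no earlier. They overlap
     pairwise on a single machine, so there is at most one. *)
  apply: (@sched_size 1 _ (fun=> 0%N)).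
    have [U _ no] := sched_filter (predC late) sS'; split=> // x y xS yS ne _.
    apply: no => //; move: xS yS; rewrite !mem_filter /= !negbK.
    by move=> /andP[/andP[/eqP-> _] _] /andP[/andP[/eqP-> _] _].
  move=> x y; rewrite !mem_filter /= !negbK.
  move=> /andP[/andP[_ x1] /end_j x2] /andP[/andP[_ y1] /end_j y2].
  by rewrite /overlap (lt_le_trans x1 y2) (lt_le_trans y1 x2).
case jS: (j \in S); last by exists g.
(* Swapping the machines [i] and [g j] brings [j] to [i]. The former jobs of [i] still fit, because
   [F (g j) <= F i] by the choice of the best fit. *)
pose sw k := if k == i then g j else if k == g j then i else k.
have swK : involutive sw.
  move=> k; rewrite /sw; case: (eqVneq k i) => [->|ki].
    by rewrite eqxx; case: eqVneq.
  case: (eqVneq k (g j)) => [->|kj]; first by rewrite eqxx.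
  by rewrite (negbTE ki) (negbTE kj).
case: sS => U lt_g no; exists (sw \o g); split.
- split=> //.
    by move=> x xS /=; rewrite /sw; case: ifP => _; [|case: ifP => _ //]; apply: lt_g.
  by move=> x y xS yS ne /= /(can_inj swK); apply: no.
- move=> x xS /=; rewrite /sw; case: (eqVneq (g x) i) => [Ei|_].
    by apply: le_trans (fS x xS); rewrite Ei best_i ?lt_g ?fS.
  case: (eqVneq (g x) (g j)) => [Ej|_]; last exact: fS.
  (* Another job on the machine of [j] does not overlap [j] and ends no earlier, so it starts after
     [j] has ended, when [i] is free as well. *)
  case: (eqVneq x j) => [->//|ne].
  have := no x j xS jS ne Ej; rewrite /overlap negb_and -!leNgt.
  case/orP=> [le_x|]; first by apply: le_trans fit_j (le_trans (ltW lt_j) le_x).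
  by move=> le_j; have := end_j x xS; lra.
- by move=> _ /=; rewrite /sw eqxx; case: eqVneq.
Qed.

Definition blt (x : R) (b : option R) : bool := if b is Some y then x < y else true.
Definition ble (x : R) (b : option R) : bool := if b is Some y then x <= y else true.

Lemma ble_blt_trans y x b : x <= y -> blt y b -> blt x b.
Proof. by case: b => //= b; apply: le_lt_trans. Qed.

Lemma bltW x b : blt x b -> ble x b.
Proof. by case: b => //= b; apply: ltW. Qed.

Definition inreg (a : R) (b : option R) (x : job) : bool :=
  (a <= job_start x) && blt (job_start x) b.

Definition optimal M (ks : seq job) a b n : Prop := forall S g, sched M S g ->
  (forall x, x \in S -> [&& x \in ks, inreg a b x & blt (job_end x) b]) ->
  (size S <= n)%N.

(** * Regions between borders, and the loss at the borders *)

Section Regions.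
Variables (M : nat) (U : R).
Implicit Types (ks L : seq job) (A : job -> nat) (D : R -> seq job).

(* [A x] is the machine of [x] plus one, or 0; [L] lists the scheduled jobs of
   the region between the borders [a] and [b], where [b = None] means infinity.
   The schedule may use jobs that end at [b], but only competes with schedules
   whose jobs end before [b]. *)
Record region_ok ks A a b L : Prop := RegionOk {
  reg_uniq : uniq L;
  reg_mem : forall x, (x \in L) = [&& x \in ks, A x != 0%N & inreg a b x];
  reg_end : forall x, x \in L -> ble (job_end x) b;
  reg_mach : forall x, x \in L -> (A x <= M)%N;
  reg_feas : forall x y, x \in L -> y \in L -> x != y -> A x = A y -> ~~ overlap x y;
  reg_opt : optimal M ks a b (size L);
  reg_size : (size L)%:R < U + 1;
  reg_strict : (size L)%:R < U -> forall x, x \in L -> blt (job_end x) b }.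

Lemma eq_region_ok ks A ks' A' a b L : region_ok ks A a b L ->
  (forall x, inreg a b x -> (x \in ks') = (x \in ks)) ->
  (forall x, x \in ks -> inreg a b x -> A' x = A x) -> region_ok ks' A' a b L.
Proof.
case=> H1 H2 H3 H4 H5 H6 H7 H8 Ek EA.
have EL x : x \in L -> A' x = A x by rewrite H2 => /and3P[? ? ?]; apply: EA.
split=> //.
- move=> x; rewrite H2; case: (boolP (inreg a b x)) => Hx; last by rewrite !andbF.
  by rewrite Ek //; case: (boolP (x \in ks)) => //= xk; rewrite EA.
- by move=> x xL; rewrite EL // H4.
- by move=> x y xL yL; rewrite !EL //; apply: H5.
move=> S g sS HS; apply: (H6 S g sS) => x /HS/and3P[xk Hx ->].
by rewrite -Ek // xk Hx.
Qed.

Definition hdb (s : seq R) (b : option R) : option R := if s is a :: _ then Some a else b.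

Fixpoint regs_ok ks A D (s : seq R) (b : option R) : Prop :=
  if s is a :: s' then region_ok ks A a (hdb s' b) (D a) /\ regs_ok ks A D s' b
  else True.

Lemma regs_ok_cat ks A D s1 s2 b :
  regs_ok ks A D (s1 ++ s2) b <->
  regs_ok ks A D s1 (hdb s2 b) /\ regs_ok ks A D s2 b.
Proof.
elim: s1 => [|a s1 IH] /=; first by tauto.
have -> : hdb (s1 ++ s2) b = hdb s1 (hdb s2 b) by case: s1 {IH}.
by rewrite IH; tauto.
Qed.

Definition inside (s : seq R) (b : option R) (x : job) : bool :=
  if s is a :: _ then inreg a b x else false.

Definition bsorted (s : seq R) (b : option R) : bool :=
  sorted <%R s && (if s is a :: s' then blt (last a s') b else true).

Lemma bsorted_cons a s b : bsorted (a :: s) b =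
  blt a (hdb s b) && bsorted s b.
Proof. by case: s => [|c s] /=; rewrite /bsorted /= ?andbT // -andbA. Qed.

Lemma bsorted_cat s1 s2 b : bsorted (s1 ++ s2) b = bsorted s1 (hdb s2 b) && bsorted s2 b.
Proof.
elim: s1 => [|a s1 IH]; first by [].
rewrite cat_cons !bsorted_cons IH andbA; congr (blt a _ && _ && _).
by case: s1 {IH}.
Qed.

Lemma blt_trans x y b : x < y -> blt y b -> blt x b.
Proof. by move=> /ltW; apply: ble_blt_trans. Qed.

Lemma bsorted_blt a s b : bsorted (a :: s) b -> blt a b.
Proof.
elim: s a => [|c s IH] a; first by rewrite /bsorted.
by rewrite bsorted_cons => /andP[/= lt_ac /IH]; apply: blt_trans.
Qed.

Lemma inside_cons a s b x : bsorted (a :: s) b ->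
  inside (a :: s) b x = inreg a (hdb s b) x || inside s b x.
Proof.
rewrite bsorted_cons; case: s => [|c s] /=; first by rewrite orbF.
case/andP=> lt_ac /bsorted_blt lt_cb; rewrite /inreg /=.
case: (ltP (job_start x) c) => xc /=; last by rewrite andbF /= (le_trans (ltW lt_ac) xc).
by rewrite andbT orbF (blt_trans xc lt_cb) andbT.
Qed.

(** Jobs of a region end by its right border and later jobs start from there on, so the machine
    numbers of the regions combine without renaming. *)
Lemma regs_feasible ks A D s b : bsorted s b -> regs_ok ks A D s b ->
  forall x y, x \in ks -> y \in ks -> inside s b x -> inside s b y ->
  A x != 0%N -> A y != 0%N -> x != y -> A x = A y ->
  ~~ overlap x y.
Proof.
elim: s => // a s IH Ss; have := Ss; rewrite bsorted_cons => /andP[_ Ss'] [ra rs].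
move=> x y xk yk; rewrite !(inside_cons _ Ss) => Hx Hy Ax Ay ne EA.
have no z t : z \in ks -> A z != 0%N -> inreg a (hdb s b) z -> inside s b t ->
    ~~ (job_start t < job_end z).
  move=> zk Az Hz; have zD : z \in D a by rewrite (reg_mem ra) zk Az.
  have := reg_end ra zD; case: (s) => //= c s' le_z /andP[le_t _].
  by rewrite -leNgt; apply: le_trans le_t.
case: (boolP (inreg a (hdb s b) x)) Hx => [Hx _|_ /= Hx];
  case: (boolP (inreg a (hdb s b) y)) Hy => [Hy _|_ /= Hy].
- have xD : x \in D a by rewrite (reg_mem ra) xk Ax.
  have yD : y \in D a by rewrite (reg_mem ra) yk Ay.
  exact: (reg_feas ra).
- by rewrite /overlap (negbTE (no x y _ _ _ _)) // andbF.
- by rewrite /overlap (negbTE (no y x _ _ _ _)).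
- exact: IH.
Qed.

Lemma regs_mach ks A D s b : bsorted s b -> regs_ok ks A D s b ->
  forall x, x \in ks -> inside s b x -> (A x <= M)%N.
Proof.
elim: s => // a s IH Ss; have := Ss; rewrite bsorted_cons => /andP[_ Ss'] [ra rs].
move=> x xk; rewrite (inside_cons _ Ss) => /orP[Hx|]; last exact: IH.
case: (eqVneq (A x) 0%N) => [->//|Ax].
by apply: (reg_mach ra); rewrite (reg_mem ra) xk Ax.
Qed.

Definition total D (s : seq R) : nat := sumn [seq size (D a) | a <- s].

Lemma region_count ks A a b L : uniq ks -> region_ok ks A a b L ->
  size L = count (fun x => (A x != 0%N) && inreg a b x) ks.
Proof.
move=> Uk r; rewrite -size_filter; apply: perm_size; apply: uniq_perm.
- exact: reg_uniq r.
- exact: filter_uniq.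
by move=> x; rewrite (reg_mem r) mem_filter andbC -andbA [_ && (x \in _)]andbC andbCA.
Qed.

Lemma regs_count ks A D s b : uniq ks -> bsorted s b -> regs_ok ks A D s b ->
  total D s = count (fun x => (A x != 0%N) && inside s b x) ks.
Proof.
move=> Uk; elim: s => [|a s IH] Ss.
  by move=> _; rewrite (eq_count (a2 := pred0)) ?count_pred0 // => x /=; rewrite andbF.
have := Ss; rewrite bsorted_cons => /andP[_ Ss'] [ra rs].
have -> : total D (a :: s) = (size (D a) + total D s)%N by [].
rewrite (IH Ss' rs) (region_count Uk ra).
rewrite -count_predUI [X in (_ + X)%N](_ : _ = 0%N) ?addn0.
  by apply: eq_count => x; rewrite (inside_cons _ Ss) andb_orr.
rewrite (eq_count (a2 := pred0)) ?count_pred0 // => x /=.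
rewrite /inreg; case: (s) => [|c s'] /=; rewrite ?andbF // /inreg.
by case: (ltP (job_start x) c); rewrite ?andbF //= -?andbA ?andbF.
Qed.

Lemma valid_lt (x : job) : valid_job x -> job_start x < job_end x.
Proof. by case/andP=> _; rewrite /job_end; lra. Qed.

(* Every inner border is crossed by at most [M] jobs. *)
Lemma optimal_size ks A D s b S g : {in ks, forall x, valid_job x} ->
  bsorted s b -> regs_ok ks A D s b -> sched M S g ->
  (forall x, x \in S -> [&& x \in ks, inside s b x & blt (job_end x) b]) ->
  (size S <= total D s + M * (size s).-1)%N.
Proof.
move=> V; elim: s S => [|a s IH] S Ss.
  by move=> _ _; case: S => // x S /(_ x); rewrite inE eqxx andbF => /(_ isT).
have := Ss; rewrite bsorted_cons => /andP[_ Ss'] [ra rs] sS HS.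
rewrite /total /= -/(total D s).
case: s Ss IH Ss' ra rs HS => [|c s] Ss IH Ss' ra rs HS.
  by rewrite muln0 !addn0; apply: (reg_opt ra sS).
pose p1 x := job_end x < c; pose p2 x := job_start x < c.
have s1 : (size (filter p1 S) <= size (D a))%N.
  apply: (reg_opt ra (sched_filter _ sS)) => x; rewrite mem_filter => /andP[px xS].
  have /and3P[xk /andP[Hx1 _] _] := HS x xS.
  by apply/and3P; split=> //; rewrite /inreg Hx1; apply: lt_trans px; apply/valid_lt/V.
(* A job that ends exactly at [c] counts as crossing, because [optimal] only bounds jobs that end
   strictly before the border. *)
have s2 : (size (filter (predI p2 (predC p1)) S) <= M)%N.
  apply: (sched_crossing (sched_filter _ sS) (b := c)) => x; rewrite mem_filter.
  by case/andP=> /andP[/= px2 px] _; apply/andP; split=> //; rewrite leNgt.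
have s3 : (size (filter (predC p2) S) <= total D (c :: s) + M * size s)%N.
  apply: (IH _ Ss' rs (sched_filter _ sS)) => x; rewrite mem_filter => /andP[/= px xS].
  have /and3P[-> /andP[_ Hx] ->] := HS x xS.
  by rewrite /inreg Hx leNgt px.
have := count_predC p1 S; rewrite -size_filter in s1 *.
have: (count (predC p1) S <=
    count (predI p2 (predC p1)) S + count (predC p2) S)%N.
  rewrite -(count_predUI (predI p2 (predC p1))); apply: leq_trans (leq_addr _ _).
  by apply: sub_count => x /= ->; rewrite andbT; case: (p2 x).
by move: s2 s3; rewrite !size_filter /=; move: s1; rewrite size_filter; lia.
Qed.

Definition adj (T : R) D (a c : R) : bool := T <= (size (D a) + size (D c))%:R.

(** Each region belongs to at most two neighbouring pairs, whence the factor 2. *)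
Lemma adj_total T D s : sorted (adj T D) s ->
  (size s).-1%:R * T <= (2 * total D s)%:R.
Proof.
case: s => [|a s]; first by rewrite mul0r ler0n.
(* The first region lies in one pair only; the copy of it that is left over makes the induction go
   through. *)
move=> /= H; suff: (size s)%:R * T + (size (D a))%:R <= (2 * total D (a :: s))%:R.
  by have := ler0n R (size (D a)); lra.
elim: s a H => [|c s IH] a /=; first by rewrite mul0r add0r ler_nat /total /=; lia.
case/andP=> ac /IH {}IH.
have -> : (2 * total D [:: a, c & s] = 2 * size (D a) + 2 * total D (c :: s))%N.
  by rewrite /total /=; lia.
move: ac IH; rewrite /adj [in X in X -> _]natrD [in X in _ -> _ -> X]natrD !natrM -natr1.
have := ler0n R (size (D c)); lra.
Qed.

End Regions.
End Schedules.

(** * The greedy algorithm *)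

Section Scheduler.
Variable R : realType.
Notation job := (job R).
Notation value := (value R).
Notation tree := (tree R).
Notation call := (pcall (R := R) prog).
Local Open Scope ring_scope.

(** Machine [i] that is free from time [x], or a border at [x] when [i = 0], posing as a job of
    length 0: its end is [x], so the minimum of end times is the earliest free machine or the next
    border. *)
Definition mkey (i : nat) (x : R) : job := (i, x, 0).
Notation bkey := (mkey 0).

(** Length 0 is below every valid length, so identifiers of machines are never compared with those
    of jobs. *)
Lemma kle_mkey i x (y : job) : valid_job y ->
  kle (mkey i x) y = (x <= job_start y).
Proof.
case/andP=> _; rewrite /kle /mkey [job_start (_, _, _)]/= [job_length (_, _, _)]/=.
move=> len; case: ifP => // _; case: ifP => // _.
have -> : 0 <= job_length y by lra.
by have -> : (job_length y <= 0) = false by apply/negbTE; rewrite -ltNge; lra.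
Qed.

Lemma mkey_inj i x i' x' : mkey i x = mkey i' x' -> i = i' /\ x = x'.
Proof. by case. Qed.

Lemma mkey_end i x : job_end (mkey i x) = x.
Proof. by rewrite /job_end /= addr0. Qed.

(** The payload is already the answer to a query. *)
Definition jleaf (A : job -> nat) (k : job) : leaf R :=
  (k, if A k == 0%N then Some k else None, VNat R (A k)).
Definition mleaf (k : job) : leaf R := (k, Some k, VNull R).
Definition rpay (L : seq job) : value := VPair (VNat R (size L)) (elist L).
Definition rleaf (D : R -> seq job) (k : job) : leaf R :=
  (k, Some k, rpay (D (job_start k))).

Definition aset (A : job -> nat) j n : job -> nat := fun x => if x == j then n else A x.

(** [W] bounds the calls of one operation on any tree with at most [Z] keys; both are chosen at the
    end from the number of jobs. *)
Variables (Z W : nat).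
Hypothesis HW : forall f ks (t : option tree),
  trep f ks t -> (size ks <= Z)%N -> (10 * (ohgt t).+1 <= W)%N.

Lemma W_gt0 : (0 < W)%N.
Proof.
have : (10 * (ohgt (None : option tree)).+1 <= W)%N by apply: (@HW mleaf [::]).
by rewrite /=; lia.
Qed.

Lemma call_jins A ks t j n : trep (jleaf A) ks t -> j \in ks -> (size ks <= Z)%N ->
  exists2 t', trep (jleaf (aset A j n)) ks t' &
  call fINS (VPair (otree t) (VPair (VPair (job_word j) (VPair (VNat R 0)
    (if n is 0%N then job_word j else VNull R))) (VNat R n))) (otree t') W.
Proof.
move=> rt jk sz; exists (oins t (jleaf (aset A j n) j)).
  rewrite -(insk_id _ jk); last by case: rt.
  by apply: (trep_ins _ rt) => // y _ ne; rewrite /jleaf /aset (negbTE ne).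
have H := HW rt sz; apply: pcall_le H _.
have [av _ _] := rt; have := call_oins (jleaf (aset A j n) j) av.
rewrite /eleaf /etree /ehead /= /jleaf /aset !eqxx /=; by case: n.
Qed.

Lemma call_mins ks t k : trep mleaf ks t -> (size ks <= Z)%N ->
  exists2 t', trep mleaf (insk k ks) t' &
  call fINS (VPair (otree t) (VPair (VPair (job_word k) (VPair (VNat R 0)
    (job_word k))) (VNull R))) (otree t') W.
Proof.
move=> rt sz; exists (oins t (mleaf k)); first exact: (trep_ins _ rt).
have H := HW rt sz; apply: pcall_le H _.
by have [av _ _] := rt; exact: (call_oins (mleaf k) av).
Qed.

Lemma call_tdel f ks t k : (forall y, lkey (f y) = y) -> trep f ks t -> (size ks <= Z)%N ->
  exists2 t', trep f [seq y <- ks | y != k] t' &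
  call fDEL (VPair (otree t) (job_word k)) (otree t') W.
Proof.
move=> fK rt sz; exists (odel t k); first exact: (trep_del _ rt).
by apply: pcall_le (HW rt sz) _; have [av _ _] := rt; exact: call_odel.
Qed.

Lemma call_tpred f ks t k : (forall y, lkey (f y) = y) -> trep f ks t -> (size ks <= Z)%N ->
  exists2 x, call fPRED (VPair (otree t) (job_word k)) (oleaf x) W &
  if x is Some x then
    exists y, [/\ x = f y, y \in ks, kle y k &
                  forall z, z \in ks -> kle z k -> kle z y]
  else forall y, y \in ks -> klt k y.
Proof.
move=> fK rt sz; exists (opred t k); last exact: (trep_pred fK rt).
by apply: pcall_le (HW rt sz) _; exact: call_opred.
Qed.

Lemma call_tbest f ks t k : (forall y, lkey (f y) = y) -> trep f ks t -> (size ks <= Z)%N ->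
  exists2 x, call fBEST (VPair (otree t) (job_word k)) (eopt x) W &
  if x is Some b then
    (exists y, [/\ y \in ks, kle k y & lbest (f y) = Some b]) /\
    (forall y c, y \in ks -> kle k y -> lbest (f y) = Some c ->
      (job_end b <= job_end c)%R)
  else forall y, y \in ks -> kle k y -> lbest (f y) = None.
Proof.
move=> fK rt sz; exists (obest t k); last exact: (trep_best fK rt).
by apply: pcall_le (HW rt sz) _; exact: call_obest.
Qed.

Variables (M : nat) (U : R) (ks : seq job).
Hypothesis M_gt0 : (0 < M)%N.
Hypothesis V : {in ks, forall x, valid_job x}.
Hypothesis ks_le : (size ks <= Z)%N.
Hypothesis Uk : uniq ks.

(** * The greedy run on one region *)

Section Greedy.
Variables (a : R) (b : option R).
Implicit Types (L mks S : seq job) (A : job -> nat) (j x y : job) (t mt : option tree).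

(* [F i] is the time from which machine [i] is free; the machines below [u] have
   not been opened yet and do not appear in the machine tree. *)
Record ginv (A : job -> nat) (F : nat -> R) (u : nat) (L mks : seq job) : Prop := GInv {
  g_u : (u <= M)%N;
  g_new : forall i, (i < u)%N -> F i = a;
  g_ge : forall i, (i < M)%N -> a <= F i;
  g_mks : forall k, k \in mks <-> exists2 i, (u <= i < M)%N & k = mkey i (F i);
  g_uniq : uniq L;
  g_mem : forall x, (x \in L) = [&& x \in ks, A x != 0%N & inreg a b x];
  g_mach : forall x, x \in L -> (A x <= M)%N;
  g_free : forall x, x \in L -> job_end x <= F (A x).-1;
  g_end : forall x, x \in L -> blt (job_end x) b;
  g_feas : forall x y, x \in L -> y \in L -> x != y -> A x = A y -> ~~ overlap x y;
  g_first : forall x y i, x \in L -> y \in ks -> A y = 0%N -> (i < M)%N ->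
    F i <= job_start y -> job_end x <= job_end y;
  g_open : (M - u <= size L)%N;
  g_size : (size L)%:R < U + 1 }.

(** Treats both choices of a machine: [u' = u] when [i] is already open, and [u = u'.+1] with
    [i = u'] when it is opened for [j]. *)
Lemma ginv_step A F u L mks j i u' (mks' : seq job) :
  ginv A F u L mks -> j \in ks -> A j = 0%N -> blt (job_end j) b ->
  (i < M)%N -> F i <= job_start j ->
  (forall y k, y \in ks -> A y = 0%N -> (k < M)%N -> F k <= job_start y ->
     job_end j <= job_end y) ->
  (size L)%:R < U ->
  (u' <= u)%N -> (forall k, (u <= k < M)%N || (k == i) = (u' <= k < M)%N) ->
  (u <= u'.+1)%N ->
  (forall k, k \in mks' <-> exists2 h, (u' <= h < M)%N &
     k = mkey h (set_at F i (job_end j) h)) ->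
  ginv (aset A j i.+1) (set_at F i (job_end j)) u' (j :: L) mks'.
Proof.
move=> [u_le new ge mk un mem mach free en feas first open sz] jk Aj bj lt_i fit_i
  min_j lt_U u'_le Hu u_le' mk'.
have jL : j \notin L by rewrite mem Aj andbF.
have lt_j := valid_lt (V jk).
have AL x : x \in L -> aset A j i.+1 x = A x.
  by rewrite /aset; case: eqVneq jL => // -> /negP.
have FL k : (k < M)%N -> F k <= set_at F i (job_end j) k.
  by rewrite /set_at; case: eqVneq => // -> _; apply: le_trans fit_i (ltW lt_j).
split=> //.
- exact: leq_trans u'_le u_le.
- move=> k lt_k; rewrite /set_at; case: eqVneq => [Ek|_].
    have := Hu k; rewrite Ek eqxx orbT => /esym/andP[]; rewrite -Ek; lia.
  by apply: new; apply: leq_trans u'_le.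
- by move=> k lt_k; apply: le_trans (ge k lt_k) (FL k lt_k).
- by rewrite /= jL.
- move=> x; rewrite inE /aset; case: eqVneq => [->|ne] /=; last exact: mem.
  rewrite jk /inreg (le_trans (ge i lt_i) fit_i) /=.
  by apply/esym/(ble_blt_trans (ltW lt_j)).
- move=> x; rewrite inE => /predU1P[->|xL]; first by rewrite /aset eqxx.
  by rewrite AL // mach.
- move=> x; rewrite inE => /predU1P[->|xL]; first by rewrite /aset /set_at !eqxx.
  rewrite AL //; apply: le_trans (free x xL) (FL _ _).
  have := mach x xL; have: A x != 0%N by move: xL; rewrite mem => /and3P[].
  by case: (A x).
- by move=> x; rewrite inE => /predU1P[->//|]; apply: en.
- have aux x : x \in L -> A x = i.+1 -> job_end x <= job_start j.
    by move=> xL Ex; have := free x xL; rewrite Ex => /le_trans; apply.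
  move=> x y; rewrite !inE => /predU1P[->|xL] /predU1P[->|yL]; rewrite ?eqxx // => ne.
  + rewrite (AL y yL) /aset eqxx /overlap => /esym/(aux y yL) le_y.
    by rewrite [job_start j < _]ltNge le_y.
  + rewrite (AL x xL) /aset eqxx /overlap => /(aux x xL) le_x.
    by rewrite [job_start j < _]ltNge le_x andbF.
  by rewrite !AL //; apply: feas.
- move=> x y k xL yk; rewrite /aset; case: eqVneq => // ne Ay lt_k fit_k.
  have {}fit_k := le_trans (FL k lt_k) fit_k.
  by move: xL; rewrite inE => /predU1P[->|xL]; [apply: (min_j y k)|apply: (first x y k)].
- by rewrite /=; lia.
- by rewrite /= -natr1; lra.
Qed.


Definition olim (e : option R) : option R := if e is Some _ then e else b.

(** [gp_opt] compares with what can still be added to the current state. In this relative form it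
    passes backwards through one greedy step, and at the start of the run it becomes optimality of
    the region. *)
Record gpost (A : job -> nat) (F : nat -> R) (L : seq job)
    (A' : job -> nat) (L' : seq job) (e : option R) : Prop := GPost {
  gp_out : forall x, ~~ ((x \in ks) && inreg a b x) -> A' x = A x;
  gp_uniq : uniq L';
  gp_mem : forall x, (x \in L') = [&& x \in ks, A' x != 0%N & inreg a b x];
  gp_mach : forall x, x \in L' -> (A' x <= M)%N;
  gp_end : forall x, x \in L' -> blt (job_end x) b;
  gp_feas : forall x y, x \in L' -> y \in L' -> x != y -> A' x = A' y -> ~~ overlap x y;
  gp_size : (size L')%:R < U + 1;
  gp_cap : forall c, e = Some c -> [/\ a < c, blt c b,
    forall x, x \in L' -> job_end x <= c & U <= (size L')%:R];
  gp_opt : forall S g, sched M S g -> fits F S g ->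
    (forall x, x \in S -> [&& x \in ks, A x == 0%N & blt (job_end x) (olim e)]) ->
    (size S + size L <= size L')%N;
  gp_left : (count (fun x => A' x == 0%N) ks + size L' <=
             count (fun x => A x == 0%N) ks + size L)%N;
  gp_mono : (size L <= size L')%N }.

Lemma gpost_stop A F u L mks e : ginv A F u L mks ->
  (forall c, e = Some c -> [/\ a < c, blt c b,
    forall x, x \in L -> job_end x <= c & U <= (size L)%:R]) ->
  (forall x i, x \in ks -> A x = 0%N -> (i < M)%N -> F i <= job_start x ->
    ~~ blt (job_end x) (olim e)) ->
  gpost A F L A L e.
Proof.
move=> [u_le new ge mk un mem mach free en feas first open sz] He Hopt; split=> //.
move=> [|x S] // g [_ lt_g _] fS HS; have xS : x \in x :: S by rewrite inE eqxx.
have /and3P[xk /eqP Ax bx] := HS x xS.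
by have := Hopt x (g x) xk Ax (lt_g x xS) (fS x xS); rewrite bx.
Qed.

Lemma count_aset A j n : j \in ks -> A j = 0%N ->
  count (fun x => A x == 0%N) ks = (count (fun x => aset A j n.+1 x == 0%N) ks).+1.
Proof.
move=> jk Aj.
have -> : count (fun x => A x == 0%N) ks =
    (count (fun x => aset A j n.+1 x == 0%N) ks + count (pred1 j) ks)%N.
  rewrite -count_predUI [X in (_ + X)%N](_ : _ = 0%N) ?addn0.
    apply: eq_count => x /=; rewrite /aset; case: (eqVneq x j) => [->|_].
      by rewrite Aj.
    by rewrite orbF.
  rewrite (eq_count (a2 := pred0)) ?count_pred0 // => x /=.
  by rewrite /aset; case: (eqVneq x j); rewrite ?andbF.
by rewrite (count_uniq_mem _ Uk) jk addn1.
Qed.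

(** By [best_fit_exchange] a competitor loses at most one job while [L] gains [j], so
    [size S + size L] does not grow in favour of the competitor. *)
Lemma gpost_step A F L j i A' (L' : seq job) e : j \in ks -> A j = 0%N -> inreg a b j ->
  (i < M)%N -> F i <= job_start j ->
  (forall k, (k < M)%N -> F k <= job_start j -> F k <= F i) ->
  (forall y k, y \in ks -> A y = 0%N -> (k < M)%N -> F k <= job_start y ->
     job_end j <= job_end y) ->
  gpost (aset A j i.+1) (set_at F i (job_end j)) (j :: L) A' L' e ->
  gpost A F L A' L' e.
Proof.
move=> jk Aj jr lt_i fit_i best_i min_j [out un mem mach en feas sz cap opt left mono].
have lt_j := valid_lt (V jk).
split=> //.
- move=> x nx; rewrite out // /aset; case: eqVneq nx => // ->.
  by rewrite jk jr.
- move=> S g sS fS HS.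
  have [|S' [g' [sS' fS' sub jS' szS]]] :=
    @best_fit_exchange R M F S g j i sS fS lt_j lt_i fit_i best_i.
    move=> x xS; have /and3P[xk /eqP Ax _] := HS x xS.
    by apply: (min_j x (g x) xk Ax); [case: sS => _ + _; apply | apply: fS].
  have H : (size S' + (size L).+1 <= size L')%N; last by lia.
  apply: (opt S' g' sS' fS') => x xS'.
  have /and3P[-> Ax ->] := HS x (sub x xS').
  by rewrite /aset; case: (eqVneq x j) xS' => [->|_ _]; [rewrite (negbTE jS') | rewrite Ax].
- apply: leq_trans left _ => /=; rewrite addnS -addSn leq_add2r.
  by rewrite (count_aset i jk Aj).
- by apply: leq_trans mono => /=.
Qed.

Definition garg t mt u L : value :=
  VPair (VPair (job_word (bkey a)) (VPair (eopt (omap bkey b)) (VReal U)))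
    (VPair (otree t) (VPair (otree mt) (VPair (VNat R u) (rpay L)))).

Definition gres t L e : value :=
  VPair (otree t) (VPair (rpay L) (eopt (omap bkey e))).

(** Every open machine was opened for a scheduled job. A tree of all machines would instead cost
    [log M], which the number of jobs does not bound. *)
Lemma ginv_mks_size A F u L mks : ginv A F u L mks -> sorted (@klt R) mks ->
  (size mks <= Z)%N.
Proof.
move=> inv /klt_sorted_uniq Um; apply: leq_trans ks_le.
apply: (@leq_trans (size L)); last first.
  apply: (uniq_leq_size (g_uniq inv)) => x; rewrite (g_mem inv).
  by case/andP.
apply: leq_trans (g_open inv).
rewrite -(size_iota u (M - u)) -(size_map (fun i => mkey i (F i))).
apply: (uniq_leq_size Um) => k /(g_mks inv)[i /andP[ui iM] ->].
by apply: map_f; rewrite mem_iota; lia.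
Qed.

(** From the key [p] on, jobs fit on some machine: [p] is the left border while an unopened machine
    remains, and the earliest free machine afterwards. *)
Lemma free_key A F u L mks mt : ginv A F u L mks -> trep mleaf mks mt ->
  exists p, (forall y, y \in ks ->
    (kle p y <-> exists2 i, (i < M)%N & F i <= job_start y)) /\
  if u is 0%N
  then call fBEST (VPair (otree mt) (job_word (bkey a))) (job_word p) W
  else p = bkey a.
Proof.
move=> inv rm; have sm : (size mks <= Z)%N by apply: (ginv_mks_size inv); case: rm.
case: u inv => [|u] inv; last first.
  exists (bkey a); split=> // y yk; rewrite kle_mkey ?V //; split=> [le_y|[i lt_i]].
    by exists 0%N => //; rewrite (g_new inv).
  by apply: le_trans; apply: (g_ge inv).
have ge i : (i < M)%N -> kle (bkey a) (mkey i (F i)).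
  move=> lt_i; have := g_ge inv lt_i; rewrite /kle /mkey /= => le_a.
  by rewrite /job_start /job_length /job_id /= le_a lexx; case: ifP.
have mem i : (i < M)%N -> mkey i (F i) \in mks.
  by move=> lt_i; apply/(g_mks inv); exists i.
have [[p|] Hc Hp] := call_tbest (bkey a) (f := mleaf) (fun=> erefl) rm sm.
  exists p; split=> // y yk; case: Hp => [[k [km _ [Ek]]] Hmin].
  rewrite /= in Ek; subst p; have [i /= lt_i Ek] := (g_mks inv k).1 km; subst k.
  rewrite kle_mkey ?V //; split=> [le_y|[h lt_h]]; first by exists i.
  apply: le_trans; have := Hmin _ _ (mem h lt_h) (ge h lt_h) erefl.
  by rewrite !mkey_end.
by have := Hp _ (mem _ M_gt0) (ge _ M_gt0).
Qed.

(** A scheduled job costs at most six tree operations and one call of [GREEDY], hence the factor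
    7. *)
Lemma greedy_spec A F u L mks t mt : ginv A F u L mks ->
  trep (jleaf A) ks t -> trep mleaf mks mt ->
  exists A' L' e t', [/\ gpost A F L A' L' e, trep (jleaf A') ks t' &
    call fGREEDY (garg t mt u L) (gres t' L' e) (7 * W * (size L' - size L).+1)].
Proof.
have [n] := ubnP (count (fun x => A x == 0%N) ks).
elim: n A F u L mks t mt => // n IH A F u L mks t mt lt_n inv rt rm.
have sm : (size mks <= Z)%N by apply: (ginv_mks_size inv); case: rm.
have W0 := W_gt0.
have [p [Hp callp]] := free_key inv rm.
have [j0 callj Hj] := call_tbest p (f := jleaf A) (fun=> erefl) rt ks_le.
(* The two searches common to all branches are run once, at the price [2 * W]; the rest of the code
   is reached by pattern matching on [GREEDY]. *)
have pre w k : wp prog (match GREEDY with Let _ (Let _ r) => r | _ => NullLit end)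
    [:: eopt j0; job_word p; garg t mt u L]
    (fun w' n' => w' = w /\ (n' + 2 * W < k)%N) -> call fGREEDY (garg t mt u L) w k.
  move=> H; apply: pcall_body => //.
  apply: (@wp_let _ _ (job_word p) W).
    case: (u) callp => [|u'] callp; ev.
      by evcall callp.
    by rewrite callp.
  move=> n1 le1; apply: (@wp_let _ _ (eopt j0) W); first by ev; evcall callj.
  by move=> n2 le2; apply: wp_mono H => w' n' [-> le_n]; split=> //; lia.
case: j0 callj Hj pre => [j|] callj Hj pre; last first.
  exists A, L, None, t; split=> //.
    apply: (gpost_stop inv) => // x i xk Ax lt_i fit.
    have /(Hj x xk) : kle p x by apply/(Hp x xk); exists i.
    by rewrite /lbest /= Ax eqxx.
  by apply: pre; ev; split=> //; rewrite subnn; lia.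
have [jk Aj pj min_j] : [/\ j \in ks, A j = 0%N, kle p j &
    forall y k, y \in ks -> A y = 0%N -> (k < M)%N -> F k <= job_start y ->
    job_end j <= job_end y].
  case: Hj => [[y [yk py]] /= Ey min].
  have [Ay Ejy] : A y = 0%N /\ y = j.
    by move: Ey; rewrite /lbest /=; case: eqP => // -> [->].
  split=> //; rewrite -?Ejy // => x k xk Ax lt_k fit; rewrite Ejy.
  apply: (min x x xk); last by rewrite /lbest /= Ax eqxx.
  by apply/(Hp x xk); exists k.
have [i0 lt_i0 fit_i0] := (Hp j jk).1 pj.
have a_le : a <= job_start j := le_trans (g_ge inv lt_i0) fit_i0.
have lt_j := valid_lt (V jk).
have {}pre w k : wp prog (match GREEDY with
      Let _ (Let _ (If _ _ (If _ stop go))) => if blt (job_end j) b then go else stop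
      | _ => NullLit end)
    [:: job_word j; job_word p; garg t mt u L]
    (fun w' n' => w' = w /\ (n' + 2 * W < k)%N) -> call fGREEDY (garg t mt u L) w k.
  move=> H; apply: pre; apply: (@wp_if _ _ false); first by [].
  apply: (@wp_if _ _ (~~ blt (job_end j) b)).
    by rewrite /garg; case: (b) => [b0|]; ev => //=; rewrite -leNgt.
  by move: H; cbn [GREEDY]; case: blt.
case bj: (blt (job_end j) b) pre => pre; last first.
  exists A, L, None, t; split=> //.
    apply: (gpost_stop inv) => // x i xk Ax lt_i fit; apply/negP => /= bx.
    by move/negP: bj; apply; apply: ble_blt_trans bx; apply: (min_j x i).
  by apply: pre; ev; split=> //; rewrite subnn; lia.
have jr : inreg a b j by rewrite /inreg a_le (ble_blt_trans (ltW lt_j)).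
case: (lerP U (size L)%:R) => capL.
  (* The new border is the end of the refused job [j]. By [g_first] all scheduled jobs end by then,
     and as [j] ends first among the jobs that fit, no candidate strictly before the border is
     missed. *)
  exists A, L, (Some (job_end j)), t; split=> //.
    apply: (gpost_stop inv) => [c [<-]|x i xk Ax lt_i fit].
      split=> //; first exact: le_lt_trans lt_j.
      by move=> x xL; apply: (g_first inv xL jk Aj lt_i0).
    by rewrite /= -leNgt; apply: (min_j x i).
  by apply: pre; rewrite /garg /rpay; cbn [GREEDY]; ev; rewrite capL; ev; split=> //; rewrite subnn; lia.
have [q callq Hq] := call_tpred j (f := mleaf) (fun=> erefl) rm sm.
(* Common end of the branches that reuse a machine and that open one. *)
have fin i u' mks' t' mt' :
    (i < M)%N -> F i <= job_start j ->
    (forall k, (k < M)%N -> F k <= job_start j -> F k <= F i) ->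
    (u' <= u)%N -> (forall k, (u <= k < M)%N || (k == i) = (u' <= k < M)%N) ->
    (u <= u'.+1)%N ->
    (forall k, k \in mks' <-> exists2 h, (u' <= h < M)%N &
      k = mkey h (set_at F i (job_end j) h)) ->
    trep (jleaf (aset A j i.+1)) ks t' -> trep mleaf mks' mt' ->
    exists A' L' e t'', [/\ gpost A F L A' L' e, trep (jleaf A') ks t'',
      (size L < size L')%N & call fGREEDY (garg t' mt' u' (j :: L)) (gres t'' L' e)
        (7 * W * (size L' - (size L).+1).+1)].
  move=> lt_i fit_i best_i le_u Hu le_u' Hm rt' rm'.
  have inv' := ginv_step inv jk Aj bj lt_i fit_i min_j capL le_u Hu le_u' Hm.
  have [|A' [L' [e [t'' [gp rt'' cg]]]]] := IH _ _ _ _ _ _ _ _ inv' rt' rm'.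
    by rewrite -ltnS -(count_aset i jk Aj).
  exists A', L', e, t''; split=> //; first exact: (gpost_step jk Aj jr lt_i fit_i best_i min_j gp).
  exact: (gp_mono gp).
have {}pre w k : wp prog (match GREEDY with
      Let _ (Let _ (If _ _ (If _ _ (If _ _ go)))) => go | _ => NullLit end)
    [:: job_word j; job_word p; garg t mt u L]
    (fun w' n' => w' = w /\ (n' + 2 * W < k)%N) -> call fGREEDY (garg t mt u L) w k.
  move=> H; apply: pre; cbn [GREEDY]; apply: (@wp_if _ _ false); last exact: H.
  by rewrite /garg /rpay; ev; rewrite leNgt capL.
case: q callq Hq => [y0|] callq Hq.
  case: Hq => y [Ey0 ym yj ymax]; subst y0.
  have [i /andP[ui iM] Ey] := (g_mks inv y).1 ym; subst y.
  rewrite kle_mkey ?V // in yj.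
  have [t' rt' ct'] := call_jins i.+1 rt jk ks_le.
  have [mt1 rm1 cm1] := call_tdel (f := mleaf) (mkey i (F i)) (fun=> erefl) rm sm.
  have [|mt' rm' cm'] := call_mins (mkey i (job_end j)) rm1.
    by apply: leq_trans sm; rewrite size_filter count_size.
  have [|||||A' [L' [e [t'' [gp rt'' lt_L cg]]]]] :=
      fin i u _ t' mt' iM yj _ _ _ _ _ rt' rm'.
  - move=> k lt_k fit_k; case: (ltnP k u) => [lt_ku|le_uk].
      by rewrite (g_new inv lt_ku); apply: (g_ge inv).
    have := ymax (mkey k (F k)); rewrite kle_mkey ?V // => H.
    have /H/(_ fit_k)/kle_start // : mkey k (F k) \in mks.
    by apply/(g_mks inv); exists k => //; rewrite le_uk.
  - by [].
  - by move=> k; case: eqVneq => [->|_]; rewrite ?orbF // ui iM.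
  - by [].
  - move=> k; rewrite mem_insk inE mem_filter; split.
      case/predU1P=> [->|/andP[ne /(g_mks inv)[h Hh Ek]]].
        by exists i; rewrite ?ui // /set_at eqxx.
      exists h => //; rewrite /set_at; case: eqVneq => // Eh.
      by move: ne; rewrite Ek Eh eqxx.
    case=> h Hh ->; rewrite /set_at; case: (eqVneq h i) => [->|ne]; first by rewrite eqxx.
    apply/orP; right; apply/andP; split; last by apply/(g_mks inv); exists h.
    by apply: contra ne => /eqP/mkey_inj[->].
  exists A', L', e, t''; split=> //; apply: pre; rewrite /garg /rpay; cbn [GREEDY]; ev.
  evcall callq; rewrite !addn1; evcall ct'; evcall cm1; evcall cm'; evcall cg.
  split=> //; clear -W0 lt_L.
  have -> : (size L' - size L = (size L' - (size L).+1).+1)%N by lia.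
  by rewrite mulnS; set X := (7 * W * _)%N; lia.
have le_u k : (u <= k < M)%N -> job_start j < F k.
  move=> Hk; have km : mkey k (F k) \in mks by apply/(g_mks inv); exists k.
  by have := Hq _ km; rewrite /klt kle_mkey ?V // -ltNge.
(* Some machine fits [j], but no open one does; so an unopened machine exists, and [i] is the last
   of them. *)
case: u => [|i] in inv le_u fin pre lt_n callp *.
  by have := le_u i0 lt_i0; rewrite ltNge fit_i0.
have Fi k : (k <= i)%N -> F k = a by move=> le_k; apply: (g_new inv).
have iM : (i < M)%N := g_u inv.
have [t' rt' ct'] := call_jins i.+1 rt jk ks_le.
have [mt' rm' cm'] := call_mins (mkey i (job_end j)) rm sm.
have [||||||A' [L' [e [t'' [gp rt'' lt_L cg]]]]] :=
    fin i i _ t' mt' iM _ _ _ _ _ _ rt' rm'.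
- by rewrite Fi.
- move=> k lt_k fit_k; case: (leqP k i) => [le_k|lt_ik]; first by rewrite !Fi.
  by have := le_u k; rewrite lt_ik lt_k ltNge fit_k => /(_ isT).
- by [].
- by move=> k; case: eqVneq => [->|ne]; rewrite ?orbT ?orbF ?leqnn ?iM //; lia.
- by [].
- move=> k; rewrite mem_insk inE; split.
    case/predU1P=> [->|/(g_mks inv)[h Hh Ek]].
      by exists i; rewrite ?leqnn ?iM // /set_at eqxx.
    exists h; first by lia.
    by rewrite /set_at; case: eqVneq => // Eh; lia.
  case=> h Hh ->; rewrite /set_at; case: (eqVneq h i) => [->|ne]; first by rewrite eqxx.
  by apply/orP; right; apply/(g_mks inv); exists h => //; lia.
exists A', L', e, t''; split=> //; apply: pre; rewrite /garg /rpay; cbn [GREEDY]; ev.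
evcall callq; rewrite subn1 addn1; evcall ct'; evcall cm'; evcall cg.
split=> //; clear -W0 lt_L.
have -> : (size L' - size L = (size L' - (size L).+1).+1)%N by lia.
by rewrite mulnS; set X := (7 * W * _)%N; lia.
Qed.

End Greedy.
End Scheduler.

(** * Solving a stretch of time *)

Section Solver.
Variable R : realType.
Notation job := (job R).
Notation value := (value R).
Notation tree := (tree R).
Notation call := (pcall (R := R) prog).
Notation bkey := (mkey 0).
Local Open Scope ring_scope.
Implicit Types (ks L : seq job) (A : job -> nat) (D : R -> seq job)
  (s pre post mid : seq R) (t bt : option tree).

Lemma eq_trep f g ks (t : option tree) : {in ks, f =1 g} -> trep f ks t -> trep g ks t.
Proof. by move=> fg [? ? E]; split=> //; rewrite E; apply/eq_in_map. Qed.

Lemma klt_bkey (x y : R) : klt (bkey x) (bkey y) = (x < y).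
Proof.
rewrite /klt /kle /mkey /job_start /job_length /job_id /= lexx leqnn ltNge.
by case: ifP => // _; rewrite if_same.
Qed.

Lemma bkey_inj : injective (bkey : R -> job).
Proof. by move=> x y []. Qed.

Definition insr (a : R) s : seq R := [seq y <- s | y < a] ++ a :: [seq y <- s | a < y].

Lemma insr_map a s : insk (bkey a) (map bkey s) = map bkey (insr a s).
Proof.
rewrite /insk /insr map_cat /= !filter_map.
by congr (_ ++ _ :: _); congr map; apply: eq_filter => y /=; rewrite klt_bkey.
Qed.

Lemma lt_sorted_split (s1 s2 : seq R) c : sorted <%R (s1 ++ c :: s2) ->
  all (fun y => y < c) s1 /\ all (fun y => c < y) s2.
Proof.
rewrite (sorted_pairwise lt_trans) pairwise_cat => /and3P[H _ /= /andP[H2 _]].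
split=> //; apply/allP => y ys; move/allrelP: H; apply=> //.
by rewrite inE eqxx.
Qed.

Lemma insr_mid (s1 s2 : seq R) c : sorted <%R (s1 ++ c :: s2) ->
  insr c (s1 ++ s2) = s1 ++ c :: s2.
Proof.
move=> /lt_sorted_split[H1 H2]; rewrite /insr !filter_cat (filter_all H1) (filter_all H2).
rewrite (@filter_none _ _ s2) ?(@filter_none _ _ s1) ?cats0 //.
  by apply: sub_all H1 => y /ltW; rewrite leNgt.
by apply: sub_all H2 => y /ltW; rewrite leNgt.
Qed.

Lemma insr_id (s1 s2 : seq R) c : sorted <%R (s1 ++ c :: s2) ->
  insr c (s1 ++ c :: s2) = s1 ++ c :: s2.
Proof.
move=> /[dup] S /lt_sorted_split[H1 H2]; rewrite -[in RHS](insr_mid S) /insr !filter_cat /=.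
by rewrite ltxx.
Qed.

Definition brep D s bt : Prop := trep (rleaf D) (map bkey s) bt.

Lemma brep_sorted D s bt : brep D s bt -> sorted <%R s.
Proof.
case=> _ + _; rewrite sorted_map; apply: sub_sorted => x y /=.
by rewrite klt_bkey.
Qed.

Definition dset D (a : R) L : R -> seq job := fun c => if c == a then L else D c.

Variables (Z W : nat).
Hypothesis HW : forall f ks (t : option tree),
  trep f ks t -> (size ks <= Z)%N -> (10 * (ohgt t).+1 <= W)%N.

Let W0 : (0 < W)%N := W_gt0 HW.

Lemma call_rins D s bt a L : brep D s bt -> (size s <= Z)%N ->
  exists2 bt', brep (dset D a L) (insr a s) bt' &
  call fINS (VPair (otree bt) (VPair (VPair (job_word (bkey a)) (VPair (VNat R 0)
    (job_word (bkey a)))) (rpay L))) (otree bt') W.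
Proof.
move=> rb sz; exists (oins bt (rleaf (dset D a L) (bkey a))).
  rewrite /brep -insr_map; apply: (trep_ins _ rb) => // y /mapP[c _ ->] ne.
  rewrite /rleaf /dset; case: eqVneq => // E.
  by case/eqP: ne; rewrite -E.
have H := HW rb; rewrite size_map in H; apply: pcall_le (H sz) _.
have [av _ _] := rb; have := call_oins (rleaf (dset D a L) (bkey a)) av.
by rewrite /eleaf /etree /ehead /= /dset eqxx.
Qed.

Definition aclear A L : job -> nat := fun x => if x \in L then 0%N else A x.

Lemma clear_spec ks A L t : trep (jleaf A) ks t -> {subset L <= ks} -> (size ks <= Z)%N ->
  exists2 t', trep (jleaf (aclear A L)) ks t' &
  call fCLEAR (VPair (otree t) (elist L)) (otree t') (2 * W * (size L).+1).
Proof.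
move=> + + sz; elim: L A t => [|j L IH] A t rt sub.
  exists t; first by apply: eq_trep rt.
  by apply: pcall_body => //; ev; split=> //; lia.
have jk : j \in ks by apply: sub; rewrite inE eqxx.
have [t1 rt1 c1] := call_jins HW 0 rt jk sz.
have [|t2 rt2 c2] := IH _ _ rt1; first by move=> x xL; apply: sub; rewrite inE xL orbT.
exists t2.
  apply: eq_trep rt2 => x _; rewrite /jleaf /aclear /aset inE.
  by case: (x \in L); rewrite ?orbT ?orbF //; case: (x == j).
apply: pcall_body => //; ev; evcall c1; evcall c2.
split=> //; clear -W0; rewrite /= mulnS; lia.
Qed.

Variables (M : nat) (T U : R).
Hypothesis M_gt0 : (0 < M)%N.
Hypothesis U_ge1 : 1 <= U.

Definition epar : value := VPair (VNat R M) (VPair (VReal T) (VReal U)).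

Definition sarg a (b : option R) t bt : value :=
  VPair epar (VPair (job_word (bkey a)) (VPair (eopt (omap bkey b))
    (VPair (otree t) (otree bt)))).

Definition nfree A ks : nat := count (fun x => A x == 0%N) ks.

(** [sv_strict] holds because the run refuses jobs that end at the old border [b]. It makes the new
    jobs a legitimate competitor of the previous optima, which bounds the new sizes. *)
Record solved ks A D a b A' D' mid : Prop := Solved {
  sv_sorted : bsorted (a :: mid) b;
  sv_A : forall x, ~~ ((x \in ks) && inreg a b x) -> A' x = A x;
  sv_D : forall c, ~~ ((a <= c) && blt c b) -> D' c = D c;
  sv_ok : regs_ok M U ks A' D' (a :: mid) b;
  sv_full : forall c, c \in belast a mid -> U <= (size (D' c))%:R;
  sv_strict : forall x, x \in ks -> inreg a b x -> A' x != 0%N -> blt (job_end x) b;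
  sv_count : (size mid + nfree A' ks <= nfree A ks)%N }.

Lemma bsortedN s : bsorted s None = sorted <%R s.
Proof. by rewrite /bsorted; case: s => //= a s; rewrite andbT. Qed.

(** [insr] covers a border [a] that is present, as in the outer call, and one that is new, as in the
    recursive call. A full region uses up at least one free job, since [U >= 1]; so the number of
    borders plus free jobs does not grow, and it bounds the border tree throughout. *)
Lemma solve_spec ks A D s0 pre a post t bt :
  {in ks, forall x, valid_job x} -> (size ks <= Z)%N -> uniq ks ->
  trep (jleaf A) ks t -> brep D s0 bt -> (size s0 <= Z)%N ->
  insr a s0 = pre ++ a :: post -> sorted <%R (pre ++ a :: post) ->
  (size (pre ++ a :: post) + nfree A ks <= Z)%N ->
  (forall x, x \in ks -> inreg a (hdb post None) x -> A x = 0%N) ->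
  exists A' D' mid t' bt', [/\ solved ks A D a (hdb post None) A' D' mid,
    trep (jleaf A') ks t', brep D' (pre ++ a :: mid ++ post) bt' &
    call fSOLVE (sarg a (hdb post None) t bt) (VPair (otree t') (otree bt'))
      (9 * W * (size mid).+1 + 7 * W * total D' (a :: mid))].
Proof.
move=> V kZ Uk; have [n] := ubnP (nfree A ks).
elim: n A D s0 pre a t bt => // n IH A D s0 pre a t bt lt_n rt rb s0Z Es0 Ss sZ A0.
set b := hdb post None.
have ginv0 : ginv M U ks a b A (fun=> a) M [::] [::].
  split=> //.
  - by move=> k; split=> [//|[i]]; lia.
  - by move=> x; apply/esym/negbTE/negP => /and3P[xk /eqP Ax /(A0 x xk)].
  - by rewrite subnn.
  - by have := U_ge1; rewrite /=; lra.
have [A1 [L1 [e [t1 [gp rt1 cg]]]]] :=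
  greedy_spec HW M_gt0 V kZ Uk ginv0 rt (And3 isT isT erefl : trep (@mleaf R) [::] None).
have [bt1 rb1 cb1] := call_rins a L1 rb s0Z.
rewrite Es0 in rb1.
have opt1 : optimal M ks a (olim b e) (size L1).
  move=> S g sS HS; rewrite -[size S]addn0; apply: (gp_opt gp sS).
    by move=> x /HS/and3P[_ /andP[]].
  move=> x /HS/and3P[xk /andP[ax bx] bx']; rewrite xk bx' andbT /= A0 // /inreg ax /=.
  case: e gp {HS cg} bx bx' => [c|] gp //= bx bx'.
  have [_ + _ _] := gp_cap gp erefl; exact: blt_trans.
have lt_ab : blt a b by move: Ss; rewrite /b; case: (post) => //= c post';
  rewrite (sorted_pairwise lt_trans) pairwise_cat /= => /and3P[_ _ /andP[/andP[]]].
have D1 c : ~~ ((a <= c) && blt c b) -> dset D a L1 c = D c.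
  by rewrite /dset; case: eqVneq => // ->; rewrite lexx lt_ab.
case: e gp cg opt1 => [c|] gp cg opt1; last first.
  exists A1, (dset D a L1), [::], t1, bt1; split=> //.
    have rok : region_ok M U ks A1 a b L1.
      split=> //; [exact: gp_uniq gp|exact: gp_mem gp| |exact: gp_mach gp|exact: gp_feas gp
        |exact: gp_size gp|by move=> _ x; apply: (gp_end gp)].
      by move=> x /(gp_end gp)/bltW.
    split=> //.
    - exact: gp_out gp.
    - by rewrite /= /dset eqxx.
    - by move=> x xk xr Ax; apply: (gp_end gp); rewrite (gp_mem gp) xk Ax.
    - have := gp_left gp; rewrite /= add0n addn0 -!/(nfree _ _); exact: leq_trans (leq_addr _ _).
  apply: pcall_body => //; rewrite /sarg /epar; ev.
  evcall cg; evcall cb1; split=> //; rewrite /total /= /dset eqxx; clear -W0.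
  by rewrite subn0 muln1 addn0 mulnS; lia.
have [ac cb endL capL] := gp_cap gp erefl.
have rok : region_ok M U ks A1 a (Some c) L1.
  split=> //; [exact: gp_uniq gp| |exact: gp_mach gp|exact: gp_feas gp
    |exact: gp_size gp|by rewrite ltNge capL].
  move=> x; apply/idP/idP => [xL|/and3P[xk Ax /andP[ax /= xc]]]; last first.
    by rewrite (gp_mem gp) xk Ax /inreg ax (blt_trans xc cb).
  have xc := endL x xL; move: xL; rewrite (gp_mem gp) => /and3P[xk -> /andP[ax _]].
  by rewrite xk /inreg ax /= (lt_le_trans (valid_lt (V x xk)) xc).
have A10 x : x \in ks -> inreg c b x -> A1 x = 0%N.
  move=> xk /andP[cx xb]; apply/eqP/negPn/negP => Ax.
  have /endL : x \in L1.
    by rewrite (gp_mem gp) xk Ax /inreg xb (le_trans (ltW ac) cx).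
  by have := valid_lt (V x xk); lra.
have S2 : sorted <%R ((pre ++ [:: a]) ++ c :: post).
  move: Ss; rewrite -!bsortedN -catA !bsorted_cat /= !bsorted_cons /= ac -/b cb lt_ab.
  by case/andP=> ->.
have L1_gt0 : (0 < size L1)%N.
  by rewrite -(ltr0n R); apply: lt_le_trans capL; apply: lt_le_trans U_ge1.
have left := gp_left gp; rewrite /= addn0 -!/(nfree _ _) in left.
have {}left : (nfree A1 ks < nfree A ks)%N by clear -left L1_gt0; lia.
have [||||||||A2 [D2 [mid [t2 [bt2 [sv rt2 rb2 cs]]]]]] :=
  IH A1 (dset D a L1) (pre ++ a :: post) (pre ++ [:: a]) c t1 bt1.
- by clear -left lt_n; lia.
- exact: rt1.
- exact: rb1.
- by clear -sZ; lia.
- by rewrite -(insr_mid S2) -catA.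
- exact: S2.
- by rewrite !size_cat /= in sZ *; clear -sZ left; lia.
- exact: A10.
have D2a : D2 a = L1.
  rewrite (sv_D sv) /dset ?eqxx //; apply/negP => /andP[ca _].
  by move: ac; rewrite ltNge ca.
have notin x : ~~ ((x \in ks) && inreg a b x) -> ~~ ((x \in ks) && inreg c b x).
  apply: contra => /andP[-> /andP[cx xb]].
  by rewrite /inreg xb (le_trans (ltW ac) cx).
exists A2, D2, (c :: mid), t2, bt2; split=> //.
- split.
  + by rewrite bsorted_cons /= ac (sv_sorted sv).
  + by move=> x nx; rewrite (sv_A sv) ?notin // (gp_out gp).
  + move=> d nd; rewrite (sv_D sv) ?D1 //; apply: contra nd => /andP[cd ->].
    by rewrite (le_trans (ltW ac) cd).
  + split; last exact: sv_ok sv.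
    rewrite D2a; apply: (eq_region_ok rok) => // x _ /andP[_ /= xc].
    apply: (sv_A sv); apply/negP => /andP[_ /andP[cx _]].
    by move: xc; rewrite ltNge cx.
  + move=> d /=; rewrite inE => /predU1P[->|]; first by rewrite D2a.
    by move=> dm; apply: (sv_full sv).
  + move=> x xk /andP[ax xb]; case: (lerP c (job_start x)) => cx.
      by apply: (sv_strict sv); rewrite /inreg ?cx.
    rewrite (sv_A sv); last by rewrite /inreg leNgt cx andbF.
    by move=> Ax; apply: (gp_end gp); rewrite (gp_mem gp) xk Ax /inreg ax.
  + by have := sv_count sv; clear -left; rewrite /=; lia.
- by move: rb2; rewrite -catA.
apply: pcall_body => //; rewrite /sarg /epar; ev.
evcall cg; evcall cb1; evcall cs; split=> //.
have -> : total D2 [:: a, c & mid] = (size L1 + total D2 (c :: mid))%N.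
  by rewrite /total /= D2a.
clear -W0; rewrite subn0 /=; set X := total _ _; lia.
Qed.

End Solver.

(** * Merging regions *)

Section Updates.
Variable R : realType.
Notation job := (job R).
Notation value := (value R).
Notation tree := (tree R).
Notation call := (pcall (R := R) prog).
Notation bkey := (mkey 0).
Local Open Scope ring_scope.
Implicit Types (ks L : seq job) (A : job -> nat) (D : R -> seq job)
  (s pre post mid : seq R) (t bt : option tree).

Lemma kle_bkey (x y : R) : kle (bkey x) (bkey y) = (x <= y).
Proof. by rewrite -[kle _ _]negbK -/(klt _ _) klt_bkey leNgt. Qed.

(** Identifier 1 puts a key just above the border with the same start, and length -1 puts it just
    below; searches with such keys find the strict successor and predecessor of a border. *)
Lemma kle_next (x y : R) : kle (mkey 1 x) (bkey y) = (x < y).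
Proof.
rewrite /kle /mkey /job_start /job_length /job_id /= lexx /=.
by case: ltgtP.
Qed.

Lemma klt_prev i (x y : R) : x <= y -> klt (i, x, -1) (bkey y).
Proof.
move=> le_xy; rewrite /klt /kle /mkey /job_start /job_length /job_id /= le_xy.
have -> : (0 <= -1 :> R) = false by apply/negbTE; rewrite -ltNge; lra.
by case: ifP.
Qed.

Lemma kle_prev i (x y : R) : x < y -> kle (bkey x) (i, y, -1).
Proof. by move=> lt_xy; apply/kltW/klt_start. Qed.

Variables (Z W : nat).
Hypothesis HW : forall f ks (t : option tree),
  trep f ks t -> (size ks <= Z)%N -> (10 * (ohgt t).+1 <= W)%N.

Let W0 : (0 < W)%N := W_gt0 HW.

Lemma call_bpred D pre a post bt (k : job) : brep D (pre ++ a :: post) bt ->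
  (size (pre ++ a :: post) <= Z)%N -> kle (bkey a) k ->
  (forall c, c \in post -> klt k (bkey c)) ->
  call fPRED (VPair (otree bt) (job_word k)) (VPair (VPair (job_word (bkey a)) (VPair (VNat R 0) (job_word (bkey a))))
    (VPair (VNat R (size (D a))) (elist (D a)))) W.
Proof.
move=> rb sz le_k gt_k; have := brep_sorted rb => /lt_sorted_split[Hpre _].
have am : bkey a \in map bkey (pre ++ a :: post).
  by rewrite map_f // mem_cat inE eqxx orbT.
have [|x cx] := call_tpred HW k (f := rleaf D) (fun=> erefl) rb; first by rewrite size_map.
case: x cx => [x|] cx; last by move=> /(_ _ am); rewrite /klt le_k.
case=> y [Ex /mapP[d ds Ey] yk ymax]; subst x y.
suff -> : a = d by [].
have := ymax _ am le_k; rewrite kle_bkey => ad.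
move: ds; rewrite mem_cat inE => /or3P[dp|/eqP//|dp].
  by move/allP: Hpre => /(_ d dp); rewrite ltNge ad.
by have := gt_k d dp; rewrite /klt yk.
Qed.

Lemma call_bpred_none D s bt (k : job) : brep D s bt -> (size s <= Z)%N ->
  (forall c, c \in s -> klt k (bkey c)) ->
  call fPRED (VPair (otree bt) (job_word k)) (VNull R) W.
Proof.
move=> rb sz gt_k.
have [|x cx] := call_tpred HW k (f := rleaf D) (fun=> erefl) rb; first by rewrite size_map.
case: x cx => [x|] cx //.
by case=> y [_ /mapP[d ds ->] yk _]; have := gt_k d ds; rewrite /klt yk.
Qed.

Lemma call_bnext D pre post bt (c : R) : brep D (pre ++ post) bt ->
  (size (pre ++ post) <= Z)%N ->
  (forall d, d \in pre -> d <= c) -> (forall d, d \in post -> c < d) ->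
  call fBEST (VPair (otree bt) (job_word (mkey 1 c)))
    (eopt (omap bkey (hdb post None))) W.
Proof.
move=> rb sz Hpre Hpost.
have [|x cx] := call_tbest HW (mkey 1 c) (f := rleaf D) (fun=> erefl) rb.
  by rewrite size_map.
case: x cx => [x|] cx.
  case=> [[y [/mapP[d ds ->]]]]; rewrite kle_next => cd [Ex] Hmin; subst x.
  have {ds} : d \in post.
    by move: ds; rewrite mem_cat => /orP[/Hpre|//]; rewrite leNgt cd.
  have := brep_sorted rb; case: post Hpost rb sz Hmin => // e post Hpost rb sz Hmin.
  move=> /lt_sorted_split[_ /allP He]; rewrite inE => /predU1P[<-//|/He ed].
  have := Hmin (bkey e) (bkey e); rewrite kle_next Hpost ?inE ?eqxx // map_f; last first.
    by rewrite mem_cat inE eqxx orbT.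
  by move=> /(_ isT isT erefl); rewrite !mkey_end leNgt ed.
case: post Hpost rb sz => [//|e post] Hpost rb sz Hn.
have := Hn (bkey e); rewrite kle_next Hpost ?inE ?eqxx // map_f.
  by move=> /(_ isT isT).
by rewrite mem_cat inE eqxx orbT.
Qed.

Lemma call_jnew ks A t j : trep (jleaf A) ks t -> (size ks <= Z)%N ->
  exists2 t', trep (jleaf (aset A j 0)) (insk j ks) t' &
  call fINS (VPair (otree t) (VPair (VPair (job_word j) (VPair (VNat R 0)
    (job_word j))) (VNat R 0))) (otree t') W.
Proof.
move=> rt sz; exists (oins t (jleaf (aset A j 0) j)).
  by apply: (trep_ins _ rt) => // y _ ne; rewrite /jleaf /aset (negbTE ne).
have H := HW rt sz; apply: pcall_le H _.
have [av _ _] := rt; have := call_oins (jleaf (aset A j 0) j) av.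
by rewrite /eleaf /etree /ehead /= /jleaf /aset !eqxx.
Qed.

Variables (M : nat) (T U : R).
Hypothesis M_gt0 : (0 < M)%N.
Hypothesis T_ge2 : 2 <= T.
Hypothesis UE : U = T + M%:R.
Variable Nb : nat.
Hypothesis NbE : U + 1 <= Nb%:R.

Let U_ge1 : 1 <= U.
Proof.
have M0 := ler0n R M; have T1 : 1 <= T by apply: le_trans T_ge2; rewrite ler1n.
by rewrite UE; apply: (le_trans T1); rewrite lerDl.
Qed.

Lemma eq_regs_ok ks A D ks' A' D' s b : bsorted s b -> regs_ok M U ks A D s b ->
  (forall x, inside s b x -> (x \in ks') = (x \in ks)) ->
  (forall x, x \in ks -> inside s b x -> A' x = A x) ->
  {in s, D' =1 D} -> regs_ok M U ks' A' D' s b.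
Proof.
elim: s => // a s IH Ss; have := Ss; rewrite bsorted_cons => /andP[_ Ss'] [ra rs] Hk HA HD.
split.
  rewrite HD ?inE ?eqxx //; apply: (eq_region_ok ra) => x.
    by move=> xr; apply: Hk; rewrite (inside_cons _ Ss) xr.
  by move=> xk xr; apply: HA => //; rewrite (inside_cons _ Ss) xr.
apply: IH => // [x xi|x xk xi|d ds].
- by apply: Hk; rewrite (inside_cons _ Ss) xi orbT.
- by apply: HA => //; rewrite (inside_cons _ Ss) xi orbT.
- by apply: HD; rewrite inE ds orbT.
Qed.

Lemma reg_size_le ks A a b L : region_ok M U ks A a b L -> (size L <= Nb)%N.
Proof.
move=> /reg_size lt_U; rewrite -(ler_nat R); apply: le_trans NbE.
exact: ltW.
Qed.

Lemma reg_sched ks A a b L : region_ok M U ks A a b L -> sched M L (fun x => (A x).-1).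
Proof.
move=> r; have pos x : x \in L -> (0 < A x)%N.
  by rewrite (reg_mem r) => /and3P[_]; rewrite lt0n.
split; [exact: reg_uniq r| |].
  by move=> x xL; have := reg_mach r xL; have := pos x xL; case: (A x).
move=> x y xL yL ne EA; apply: (reg_feas r xL yL ne).
by have := pos x xL; have := pos y yL; move: EA; case: (A x) (A y) => [|?] [|?] //= ->.
Qed.

Definition marg (c : R) t bt : value :=
  VPair (epar M T U) (VPair (job_word (bkey c)) (VPair (otree t) (otree bt))).

Lemma merge_first D c post t bt : brep D (c :: post) bt -> (size (c :: post) <= Z)%N ->
  call fMERGE (marg c t bt) (VPair (otree t) (otree bt)) (2 * W).
Proof.
move=> rb sz; have /= := brep_sorted rb; rewrite (path_sortedE lt_trans) => /andP[/allP Hc _].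
have cp := call_bpred_none (k := (0%N, c, -1)) rb sz.
apply: pcall_body => //; rewrite /marg /epar; ev.
do 2 eexists; split.
  rewrite sub0r; apply: cp => d; rewrite inE => /predU1P[->|/Hc/ltW]; exact: klt_prev.
by ev; split=> //; clear -W0; lia.
Qed.

(** The condition on neighbours is a lower bound, so of the merged region only lower bounds are
    recorded. *)
Record merged D p c post D' post' : Prop := Merged {
  mg_adj : [/\ D' = D, post' = c :: post & adj T D p c] \/
           [/\ post' = post, (size (D p) <= size (D' p))%N & (size (D c) <= size (D' p))%N];
  mg_D : forall d, d != p -> d \in post' -> D' d = D d;
  mg_D' : forall d, d < p -> D' d = D d }.

Lemma merge_spec ks A D pre p c post t bt :
  {in ks, forall x, valid_job x} -> uniq ks ->
  trep (jleaf A) ks t -> brep D (pre ++ p :: c :: post) bt ->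
  (size (pre ++ p :: c :: post) + size ks <= Z)%N ->
  regs_ok M U ks A D (pre ++ p :: c :: post) None ->
  exists A' D' post' t' bt',
    [/\ merged D p c post D' post',
        regs_ok M U ks A' D' (pre ++ p :: post') None,
        trep (jleaf A') ks t', brep D' (pre ++ p :: post') bt' &
        call fMERGE (marg c t bt) (VPair (otree t') (otree bt')) (25 * W * Nb.+1)].
Proof.
move=> V Uk rt rb sZ ok; have Ss := brep_sorted rb.
have [/allP Hpre /allP Hpost] := lt_sorted_split Ss.
have [Hpre' Hpost'] : (forall d, d \in pre ++ [:: p] -> d < c) /\
    (forall d, d \in post -> c < d).
  have := Ss; rewrite -cat1s catA => /lt_sorted_split[/allP ? /allP ?].
  by split.
have pc : p < c by apply: Hpre'; rewrite mem_cat inE eqxx orbT.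
have [sz1 kZ] : (size (pre ++ p :: c :: post) <= Z)%N /\ (size ks <= Z)%N.
  by clear -sZ; lia.
have cp : call fPRED (VPair (otree bt) (job_word (0%N, c, -1))) (VPair (VPair (job_word (bkey p)) (VPair (VNat R 0) (job_word (bkey p))))
    (VPair (VNat R (size (D p))) (elist (D p)))) W.
  apply: (call_bpred rb) => //; first exact: kle_prev.
  move=> d; rewrite inE => /predU1P[->|/Hpost'/ltW]; exact: klt_prev.
have cq : call fPRED (VPair (otree bt) (job_word (bkey c))) (VPair (VPair (job_word (bkey c)) (VPair (VNat R 0) (job_word (bkey c))))
    (VPair (VNat R (size (D c))) (elist (D c)))) W.
  have rb' := rb; rewrite -cat1s catA in rb' sz1; apply: (call_bpred rb') => //.
    exact: kle_refl.
  by move=> d /Hpost'; rewrite klt_bkey.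
case: (lerP T (size (D p) + size (D c))%:R) => adjT.
  exists A, D, (c :: post), t, bt; split=> //; first by split=> //; left; split.
  apply: pcall_body => //; rewrite /marg /epar; ev.
  do 2 eexists; split; first by rewrite sub0r; exact: cp.
  ev; evcall cq; rewrite adjT; ev; split=> //; clear -W0; lia.
have [okpre [okp [okc okpost]]] : regs_ok M U ks A D pre (Some p) /\
    region_ok M U ks A p (Some c) (D p) /\ region_ok M U ks A c (hdb post None) (D c) /\
    regs_ok M U ks A D post None.
  by move/regs_ok_cat: ok => /= [? [? [? ?]]].
set b := hdb post None in okc.
have cb : blt c b by rewrite /b; case: (post) Hpost' => //= e post' ->; rewrite ?inE ?eqxx.
have inregU x : inreg p b x = inreg p (Some c) x || inreg c b x.
  rewrite /inreg /=; case: (ltP (job_start x) c) => xc /=.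
    by rewrite andbT orbF (blt_trans xc cb) andbT.
  by rewrite andbF (le_trans (ltW pc) xc).
have [t1 rt1 ct1] := clear_spec HW rt (L := D p) ltac:(by move=> x; rewrite (reg_mem okp) => /and3P[]) kZ.
have [t2 rt2 ct2] := clear_spec HW rt1 (L := D c) ltac:(by move=> x; rewrite (reg_mem okc) => /and3P[]) kZ.
have [bt2 rb2' cb2] := call_tdel HW (bkey c) (f := rleaf D) (fun=> erefl) rb ltac:(by rewrite size_map).
have rb2 : brep D (pre ++ p :: post) bt2.
  move: rb2'; rewrite /brep filter_map (eq_filter (a2 := fun d => d != c)); last first.
    by move=> d /=; rewrite (inj_eq (@bkey_inj R)).
  have H1 : all (fun d => d != c) (pre ++ [:: p]).
    by apply/allP => d /Hpre'/lt_eqF ->.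
  have H2 : all (fun d => d != c) post by apply/allP => d /Hpost'/gt_eqF ->.
  by rewrite -cat1s catA filter_cat /= eqxx /= (filter_all H1) (filter_all H2) -catA.
set A2 := aclear (aclear A (D p)) (D c) in rt2.
have A20 x : x \in ks -> inreg p b x -> A2 x = 0%N.
  move=> xk; rewrite inregU => xr; rewrite /A2 /aclear.
  case: ifPn => // xc; case: ifPn => // xp; apply/eqP/negPn/negP => Ax.
  move: xc xp; rewrite (reg_mem okp) (reg_mem okc) xk Ax /=.
  by move: xr => /orP[] ->.
have sz2 : (size (pre ++ p :: post) + nfree A2 ks <= Z)%N.
  have := count_size (fun x => A2 x == 0%N) ks; rewrite -/(nfree A2 ks).
  by move: sZ; rewrite !size_cat /=; clear; lia.
have Ss2 : sorted <%R (pre ++ p :: post) := brep_sorted rb2.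
have sz2' : (size (pre ++ p :: post) <= Z)%N by clear -sz2; lia.
have [A3 [D3 [mid [t3 [bt3 [sv rt3 rb3 cs]]]]]] :=
  solve_spec HW T M_gt0 U_ge1 V kZ Uk rt2 rb2 sz2' (insr_id Ss2) Ss2 sz2 A20.
have [r3 _] : region_ok M U ks A3 p (hdb mid b) (D3 p) /\ True by have [] := sv_ok sv.
(* A second region would mean that the first is full, with at least [U] jobs. But its jobs compete
   with the two old regions across the single border [c], so there are fewer than [T + M = U] of
   them. *)
have {rb3 cs} [Em rb3 cs] : [/\ mid = [::], brep D3 (pre ++ p :: post) bt3 &
    call fSOLVE (sarg M T U p b t2 bt2) (VPair (otree t3) (otree bt3))
      (9 * W + 7 * W * size (D3 p))].
  case: mid sv r3 rb3 cs => [|e mid] sv r3 rb3 cs.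
    by split=> //; move: cs; rewrite muln1 /total /= addn0.
  have /(sv_full sv) : p \in belast p (e :: mid) by rewrite /= inE eqxx.
  rewrite leNgt => /negP[].
  have eb : blt e b.
    by have := sv_sorted sv; rewrite bsorted_cons => /andP[_ /bsorted_blt].
  have le_S : (size (D3 p) <= total D [:: p; c] + M * 1)%N.
    apply: (@optimal_size R M U ks A D [:: p; c] b _ (fun x => (A3 x).-1) V).
    - by rewrite !bsorted_cons /= pc cb.
    - by split.
    - exact: reg_sched r3.
    move=> x; rewrite (reg_mem r3) => /and3P[xk Ax /andP[px /= xe]].
    have xr : inreg p b x by rewrite /inreg px (blt_trans xe eb).
    by rewrite xk /= xr (sv_strict sv).
  rewrite UE; move: le_S; rewrite /total /= addn0 muln1 -(ler_nat R) natrD.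
  by move=> le_S; apply: le_lt_trans le_S _; rewrite ltrD2r.
subst mid; rewrite /= -/b in r3.
have A3E x : ~~ inreg p b x -> A3 x = A x.
  move=> nx; rewrite (sv_A sv); last by rewrite (negbTE nx) andbF.
  rewrite /A2 /aclear; move: nx; rewrite inregU negb_or (reg_mem okp) (reg_mem okc).
  by case/andP=> /negbTE-> /negbTE->; rewrite !andbF.
have Hb d : d \in post -> ~~ blt d b.
  rewrite /b; have := Ss; rewrite -cat1s catA -(cat1s c) catA.
  case: (post) => // e post' /lt_sorted_split[_ /allP He].
  by rewrite inE /= -leNgt => /predU1P[->//|/He/ltW].
have := Ss2; rewrite -bsortedN bsorted_cat bsorted_cons => /and3P[Spre _ Spost].
exists A3, D3, post, t3, bt3; split=> //.
- split.
  + right; split=> //; apply: (reg_opt r3).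
    * exact: reg_sched okp.
    * move=> x xD; have := reg_end okp xD; move: xD; rewrite (reg_mem okp).
      move=> /and3P[xk _ xr] /= xc.
      by rewrite xk inregU xr (ble_blt_trans xc cb).
    * exact: reg_sched okc.
    (* A region this small was not cut off by the cap, so by [reg_strict] its jobs end strictly
       before [b] and the new optimum must match them. *)
    * have lt_U : (size (D c))%:R < U.
        rewrite UE; apply: le_lt_trans (lt_le_trans adjT _).
          by rewrite ler_nat leq_addl.
        by rewrite lerDl.
      move=> x xD; have := reg_strict okc lt_U xD; move: xD; rewrite (reg_mem okc).
      by move=> /and3P[xk _ xr] ->; rewrite xk inregU xr orbT.
  + move=> d _ dp; apply: (sv_D sv).
    by rewrite (negbTE (Hb d dp)) andbF.
  + by move=> d dp; apply: (sv_D sv); rewrite leNgt dp.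
- apply/regs_ok_cat; split; last split=> //.
  + apply: (eq_regs_ok Spre okpre) => // [x _ xi|d dp].
      apply: A3E; move: xi; rewrite /inside /inreg; case: (pre) => // ? ?.
      by case/andP=> _ /= xp; rewrite leNgt xp.
    by apply: (sv_D sv); rewrite leNgt Hpre.
  + apply: (eq_regs_ok Spost okpost) => // [x _ xi|d dp].
      apply: A3E; move: xi; rewrite /inside /inreg /b; case: (post) => // e ?.
      by case/andP=> ex _; rewrite /= ltNge ex andbF.
    by apply: (sv_D sv); rewrite (negbTE (Hb d dp)) andbF.
have cn : call fBEST (VPair (otree bt2) (job_word (mkey 1 c))) (eopt (omap bkey b)) W.
  apply: (@call_bnext D (pre ++ [:: p])) => //; rewrite -?catA //.
  by move=> d /Hpre'/ltW.
have kp := reg_size_le okp; have kc := reg_size_le okc; have k3 := reg_size_le r3.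
apply: pcall_body => //; rewrite /marg /epar; ev.
do 2 eexists; split; first by rewrite sub0r; exact: cp.
ev; evcall cq; rewrite leNgt adjT; ev; evcall ct1; evcall ct2; evcall cb2; evcall cn; evcall cs.
split=> //; clear -W0 kp kc k3.
have := leq_mul (leqnn W) kp; have := leq_mul (leqnn W) kc; have := leq_mul (leqnn W) k3.
lia.
Qed.

End Updates.

(** * Updates *)

Section UpdateSpec.
Variable R : realType.
Notation job := (job R).
Notation value := (value R).
Notation tree := (tree R).
Notation call := (pcall (R := R) prog).
Notation bkey := (mkey 0).
Local Open Scope ring_scope.
Implicit Types (ks L : seq job) (A : job -> nat) (D : R -> seq job)
  (s pre post mid : seq R) (t bt : option tree).

Lemma locate s c (x : R) : path <%R c s -> c <= x ->
  exists pre a post, [/\ c :: s = pre ++ a :: post, a <= x & blt x (hdb post None)].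
Proof.
elim: s c => [|d s IH] c /=; first by move=> _ cx; exists [::], c, [::].
case/andP=> cd Sd cx; case: (lerP d x) => dx; last by exists [::], c, (d :: s).
by have [pre [a [post [-> ax xb]]]] := IH d Sd dx; exists (c :: pre), a, post.
Qed.

Lemma adj_mono T D D' s : (forall x, x \in s -> (size (D x) <= size (D' x))%N) ->
  sorted (adj T D) s -> sorted (adj T D') s.
Proof.
move=> le_D; apply: (sub_in_sorted (P := mem s)); last exact/allP.
move=> x y xs ys; rewrite /adj => /le_trans; apply; rewrite ler_nat.
by apply: leq_add; apply: le_D.
Qed.

(** The pair of [p] and [c] passes the test or disappears, and the merged region is no smaller than
    either part, so the pairs on both sides survive. *)
Lemma adj_merged T D pre p c post D' post' :
  sorted <%R (pre ++ p :: c :: post) -> merged T D p c post D' post' ->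
  sorted (adj T D) (pre ++ [:: p]) -> sorted (adj T D) (c :: post) ->
  sorted (adj T D') (pre ++ p :: post').
Proof.
move=> /[dup] /lt_sorted_split[/allP Hpre /allP Hpost] _ mg S1 S2.
rewrite sorted_cat_cons -cats1; case: mg => [[[-> -> pc]|[Ep le_p le_c]] mD mD'].
  by rewrite S1 /= pc.
subst post'; apply/andP; split.
  apply: adj_mono S1 => x; rewrite mem_cat inE => /orP[/Hpre xp|/eqP->//].
  by rewrite mD'.
have ne d : d \in post -> d != p.
  by move=> dp; apply: contraTneq (Hpost d _) => [->|]; rewrite ?ltxx // inE dp orbT.
case: post ne mD S2 {Hpost} => //= e post ne mD /andP[ce Se]; apply/andP; split.
  have De : D' e = D e by apply: mD; rewrite ?ne ?inE ?eqxx.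
  by move: ce; rewrite /adj De => /le_trans; apply; rewrite ler_nat leq_add2r.
have: sorted (adj T D) (e :: post) by [].
by apply: adj_mono => d dp; rewrite mD // ne.
Qed.

(** All regions of the stretch but the last contain a job; this bounds the number of calls of
    [SOLVE]. *)
Lemma size_mid_total (U : R) D a mid : 1 <= U ->
  (forall c, c \in belast a mid -> U <= (size (D c))%:R) ->
  (size mid <= total D (a :: mid))%N.
Proof.
move=> U1; elim: mid a => [|c mid IH] a H //=.
have /(le_trans U1) : U <= (size (D a))%:R by apply: H; rewrite /= inE eqxx.
rewrite ler1n => a1; have {}IH : (size mid <= total D (c :: mid))%N.
  by apply: IH => d dm; apply: H; rewrite /= inE dm orbT.
by move: IH; rewrite /total /= -/(total D mid); lia.
Qed.

Variables (Z W : nat).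
Hypothesis HW : forall f ks (t : option tree),
  trep f ks t -> (size ks <= Z)%N -> (10 * (ohgt t).+1 <= W)%N.

Let W0 : (0 < W)%N := W_gt0 HW.

Variables (M : nat) (T U eps : R).
Hypothesis M_gt0 : (0 < M)%N.
Hypothesis T_ge2 : 2 <= T.
Hypothesis TE : T = (M + M)%:R / eps + 2.
Hypothesis UE : U = T + M%:R.
Variable Nb : nat.
Hypothesis NbE : U + 1 <= Nb%:R.

Let U_ge1 : 1 <= U.
Proof.
have M0 := ler0n R M; have T1 : 1 <= T by apply: le_trans T_ge2; rewrite ler1n.
by rewrite UE; apply: (le_trans T1); rewrite lerDl.
Qed.

Record state ks A D s t bt : Prop := State {
  st_valid : {in ks, forall x, valid_job x};
  st_head : exists s', s = 0 :: s';
  st_ok : regs_ok M U ks A D s None;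
  st_adj : sorted (adj T D) s;
  st_t : trep (jleaf A) ks t;
  st_bt : brep D s bt }.

(** This is where [T >= 2] cancels the factor 2 of [adj_total]. *)
Lemma state_size ks A D s t bt : state ks A D s t bt -> (size s <= (size ks).+1)%N.
Proof.
case=> _ _ ok ad rt rb.
have Ss : bsorted s None by rewrite bsortedN; apply: brep_sorted rb.
have Uk : uniq ks by case: rt => _ /klt_sorted_uniq.
have := adj_total ad; rewrite (regs_count Uk Ss ok).
set k := count _ _; have kk : (k <= size ks)%N := count_size _ _.
move=> H; suff : ((size s).-1 * 2 <= 2 * k)%N by lia.
rewrite -(ler_nat R); apply: le_trans H; rewrite natrM ler_wpM2l //.
Qed.

Definition root0 : option tree := Some (Leaf (rleaf (fun=> [::]) (bkey 0))).

Lemma state0 A : state [::] A (fun=> [::]) [:: 0] None root0.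
Proof.
split=> //; first by exists [::].
split=> //; split=> //.
- by move=> [|x S] // g _ /(_ x); rewrite inE eqxx => /(_ isT).
- by rewrite ltr_wpDl // (le_trans _ U_ge1).
Qed.

Definition uarg (root : value) (j : job) (flag : bool) : value :=
  VPair root (VPair (job_word j) (VPair (VNat R M) (VPair (VReal eps)
    (VNat R flag)))).

(** The blank memory holds null in place of the encoding of [root0], which is built by the first
    update. *)
Definition root_rep (root : value) t bt : Prop :=
  root = VPair (otree t) (otree bt) \/ [/\ root = VNull R, t = None & bt = root0].

(** * A single insertion or deletion *)

Section Step.
Variables (ks : seq job) (A : job -> nat) (D : R -> seq job) (s : seq R).
Variables (t bt : option tree) (j : job) (flag : bool).
Hypothesis st : state ks A D s t bt.
Hypothesis jV : valid_job j.
Hypothesis jk : (j \notin ks) = flag.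
Hypothesis kZ : (4 * size ks + 8 <= Z)%N.

Lemma update_jobs L : {subset L <= ks} ->
  exists ks' A' t1 t', [/\ trep (jleaf A') ks' t',
    call fCLEAR (VPair (otree t) (elist L)) (otree t1) (2 * W * (size L).+1),
    (if flag
     then call fINS (VPair (otree t1) (VPair (VPair (job_word j) (VPair (VNat R 0)
            (job_word j))) (VNat R 0))) (otree t') W
     else call fDEL (VPair (otree t1) (job_word j)) (otree t') W),
    forall x, (x \in ks') = if flag then (x == j) || (x \in ks) else (x != j) && (x \in ks) &
    forall x, x \in ks' -> A' x = if (x == j) || (x \in L) then 0%N else A x].
Proof.
move=> sub; have kZ' : (size ks <= Z)%N by clear -kZ; lia.
have [t1 rt1 c1] := clear_spec HW (st_t st) sub kZ'.
case: flag jk => jk'.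
  have [t2 rt2 c2] := call_jnew HW j rt1 kZ'.
  exists (insk j ks), (aset (aclear A L) j 0), t1, t2; split=> //.
    by move=> x; rewrite mem_insk inE.
  by move=> x _; rewrite /aset /aclear; case: (x == j).
have [t2 rt2 c2] := call_tdel HW j (f := jleaf (aclear A L)) (fun=> erefl) rt1 kZ'.
exists [seq x <- ks | x != j], (aclear A L), t1, t2; split=> //.
  by move=> x; rewrite mem_filter.
by move=> x; rewrite mem_filter /aclear => /andP[/negbTE-> _].
Qed.

(* Without [j], the new schedule of the region competes with the old one. *)
Lemma resolved_total ks' A3 D3 a b mid :
  uniq ks' -> (forall x, x != j -> (x \in ks') = (x \in ks)) ->
  region_ok M U ks A a b (D a) -> bsorted (a :: mid) b ->
  regs_ok M U ks' A3 D3 (a :: mid) b ->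
  (forall x, x \in ks' -> inreg a b x -> A3 x != 0%N -> blt (job_end x) b) ->
  (total D3 (a :: mid) <= Nb.+1)%N.
Proof.
move=> Uk' kE oka Sm okm strict; rewrite (regs_count Uk' Sm okm) -size_filter.
set S := filter _ _.
have sS : sched M S (fun x => (A3 x).-1).
  have H x : x \in S -> [/\ x \in ks', A3 x != 0%N & inside (a :: mid) b x].
    by rewrite mem_filter => /andP[/andP[? ?] ?].
  split; first exact: filter_uniq.
    move=> x /H[xk Ax xi]; have := regs_mach Sm okm xk xi.
    by case: (A3 x) Ax.
  move=> x y /H[xk Ax xi] /H[yk Ay yi] ne EA.
  have {}EA : A3 x = A3 y by case: (A3 x) (A3 y) Ax Ay EA => [|?] [|?] //= _ _ ->.
  exact: (regs_feasible Sm okm xk yk xi yi Ax Ay ne EA).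
have le_D : (size [seq x <- S | x != j] <= size (D a))%N.
  apply: (reg_opt oka (sched_filter _ sS)) => x; rewrite !mem_filter.
  move=> /andP[ne /andP[/andP[Ax xi] xk]].
  by rewrite -kE // xk /= [inreg a b x]xi strict.
have -> : size S = (count (pred1 j) S + size [seq x <- S | x != j])%N.
  by rewrite size_filter -(count_predC (pred1 j)).
have c1 : (count (pred1 j) S <= 1)%N by rewrite count_uniq_mem ?leq_b1 // filter_uniq.
by rewrite -add1n leq_add // (leq_trans le_D) // (reg_size_le NbE oka).
Qed.

(** Only the region that contains the start of [j] is solved again, and the condition on neighbours
    is then restored at its two ends. *)
Lemma update_spec root : root_rep root t bt ->
  exists ks' A' D' s' t' bt', [/\ state ks' A' D' s' t' bt',
    forall x, (x \in ks') = if flag then (x == j) || (x \in ks) else (x != j) && (x \in ks) &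
    call fUPD (uarg root j flag) (VPair (otree t') (otree bt')) (100 * W * Nb.+1)].
Proof.
move=> Hroot; have sn := state_size st; have [V [s' Es] ok ad rt rb] := st.
have Ss := brep_sorted rb.
have [pre [a [post [Ea aj jb]]]] : exists pre a post,
    [/\ s = pre ++ a :: post, a <= job_start j & blt (job_start j) (hdb post None)].
  by rewrite Es; apply: locate; [rewrite Es in Ss | case/andP: jV].
rewrite Ea in ok ad rb Ss; set b := hdb post None in jb.
have [/allP Hpre /allP Hpost] := lt_sorted_split Ss.
move/regs_ok_cat: (ok) => [okpre /= [oka okpost]]; rewrite -/b in oka.
have sZ : (size (pre ++ a :: post) <= Z)%N by rewrite -Ea; clear -sn kZ; lia.
have [|ks' [A2 [t1 [t2 [rt2 c1 c2 kE A2E]]]]] := @update_jobs (D a).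
  by move=> x; rewrite (reg_mem oka) => /andP[].
have kE' x : x != j -> (x \in ks') = (x \in ks).
  by rewrite kE => /negbTE ->; case: flag.
have V' : {in ks', forall x, valid_job x}.
  move=> x; rewrite kE; case: flag; first by case/predU1P=> [->//|]; apply: V.
  by case/andP=> _; apply: V.
have Uk' : uniq ks' by case: rt2 => _ /klt_sorted_uniq.
have Uk : uniq ks by case: rt => _ /klt_sorted_uniq.
have sk' : (size ks' <= (size ks).+1)%N.
  rewrite -[leqRHS]/(size (j :: ks)); apply: uniq_leq_size => // x; rewrite kE inE.
  by case: flag => // /andP[_ ->]; rewrite orbT.
have jr : inreg a b j by rewrite /inreg aj.
have A20 x : x \in ks' -> inreg a b x -> A2 x = 0%N.
  move=> xk xr; rewrite A2E //; case: eqVneq => //= ne; case: ifPn => // nx.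
  apply/eqP/negPn/negP => Ax; move: nx; rewrite (reg_mem oka).
  by rewrite -kE' // xk Ax xr.
have ks'Z : (size ks' <= Z)%N by clear -sk' kZ; lia.
have sZ2 : (size (pre ++ a :: post) + nfree A2 ks' <= Z)%N.
  have := count_size (fun x => A2 x == 0%N) ks'; rewrite -/(nfree A2 ks') -Ea.
  by clear -sn kZ sk'; lia.
have [A3 [D3 [mid [t3 [bt3 [sv rt3 rb3 cs]]]]]] :=
  solve_spec HW T M_gt0 U_ge1 V' ks'Z Uk' rt2 rb sZ (insr_id Ss) Ss sZ2 A20.
rewrite -/b in sv cs.
have A3E x : x \in ks -> ~~ inreg a b x -> A3 x = A x.
  move=> xk nx; rewrite (sv_A sv); last by rewrite (negbTE nx) andbF.
  have xj : x != j by apply: contraNneq nx => ->.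
  rewrite A2E ?kE' // (negbTE xj) /=; case: ifP => //.
  by rewrite (reg_mem oka) (negbTE nx) !andbF.
have Hb d : d \in post -> ~~ blt d b.
  rewrite /b; move: Ss; rewrite -cat1s catA; case: (post) => // e post' /lt_sorted_split[_ /allP He].
  by rewrite inE /= -leNgt => /predU1P[->//|/He/ltW].
have := Ss; rewrite -bsortedN bsorted_cat bsorted_cons => /and3P[Spre _ Spost].
have npre x : inside pre (Some a) x -> ~~ inreg a b x.
  rewrite /inside /inreg; case: (pre) => // ? ? /andP[_ /= xa].
  by rewrite leNgt xa.
have npost x : inside post None x -> ~~ inreg a b x.
  rewrite /inside /inreg /b; case: (post) => // e ? /andP[ex _].
  by rewrite /= [_ < e]ltNge ex andbF.
have D3pre d : d \in pre -> D3 d = D d.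
  by move=> dp; apply: (sv_D sv); rewrite leNgt Hpre.
have D3post d : d \in post -> D3 d = D d.
  by move=> dp; apply: (sv_D sv); rewrite (negbTE (Hb d dp)) andbF.
have ok3 : regs_ok M U ks' A3 D3 (pre ++ a :: mid ++ post) None.
  apply/regs_ok_cat; split; last (rewrite -cat_cons; apply/regs_ok_cat; split).
  - apply: (eq_regs_ok Spre okpre) => // [x xi|x xk xi].
      by apply: kE'; apply: contraNneq (npre x xi) => ->.
    by apply: A3E => //; apply: npre.
  - exact: sv_ok sv.
  - apply: (eq_regs_ok Spost okpost) => // [x xi|x xk xi].
      by apply: kE'; apply: contraNneq (npost x xi) => ->.
    by apply: A3E => //; apply: npost.
have tot3 := resolved_total Uk' kE' oka (sv_sorted sv) (sv_ok sv) (sv_strict sv).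
have mid3 := leq_trans (size_mid_total U_ge1 (sv_full sv)) tot3.
have sz3 : (size (pre ++ a :: mid ++ post) + size ks' <= Z)%N.
  have := sv_count sv; have := count_size (fun x => A2 x == 0%N) ks'.
  rewrite -/(nfree A2 ks') Ea in sn *; move: sn; rewrite !size_cat /= size_cat.
  by clear -kZ sk'; lia.
have := ad; rewrite sorted_cat_cons => /andP[adpre adpost].
(* Within the stretch every pair starts with a full region, which alone has [U >= T] jobs. *)
have adm : sorted (adj T D3) (a :: mid).
  have full := sv_full sv; elim: (mid) (a) full => //= e mid' IH d full.
  apply/andP; split; last by apply: IH => f fm; apply: full; rewrite inE fm orbT.
  have := full d; rewrite inE eqxx => /(_ isT) Ud; rewrite /adj natrD.
  by apply: le_trans (le_trans Ud _); rewrite ?UE lerDl.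
have cnext : call fBEST (VPair (otree bt) (job_word (mkey 1 a))) (eopt (omap bkey b)) W.
  apply: (@call_bnext R Z W HW D (pre ++ [:: a])); rewrite -?catA //.
  by move=> d; rewrite mem_cat inE => /orP[/Hpre/ltW|/eqP->].
have [A4 [D4 [post4 [t4 [bt4 [ok4 rt4 rb4 ad4 [D4pre sz4 c4]]]]]]] :
  exists A4 D4 post4 t4 bt4, [/\ regs_ok M U ks' A4 D4 (pre ++ a :: mid ++ post4) None,
    trep (jleaf A4) ks' t4, brep D4 (pre ++ a :: mid ++ post4) bt4,
    sorted (adj T D4) (a :: mid ++ post4) &
    [/\ forall d, d \in pre -> D4 d = D d,
        (size (pre ++ a :: mid ++ post4) + size ks' <= Z)%N &
        if b is Some c then call fMERGE (marg M T U c t3 bt3)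
          (VPair (otree t4) (otree bt4)) (25 * W * Nb.+1)
        else t4 = t3 /\ bt4 = bt3]].
  have [Ep|[c [post2 Ep]]] : post = [::] \/ exists c post2, post = c :: post2.
    by case: (post) => [|c post2]; [left|right; exists c, post2].
    rewrite /b Ep; exists A3, D3, post, t3, bt3; split=> //.
    by rewrite Ep cats0.
  (* The left partner in the merge at [c] is the last region of the new stretch. *)
  have EL q : pre ++ a :: mid ++ q = (pre ++ belast a mid) ++ last a mid :: q.
    by rewrite -cat_cons lastI cat_rcons catA.
  rewrite /b Ep; rewrite Ep EL in rb3 ok3 sz3.
  have [A4 [D4 [post4 [t4 [bt4 [mg ok4 rt4 rb4 c4]]]]]] :=
    merge_spec HW M_gt0 T_ge2 UE NbE V' Uk' rt3 rb3 sz3 ok3.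
  have S3 := brep_sorted rb3; have [/allP Hl _] := lt_sorted_split S3.
  exists A4, D4, post4, t4, bt4; rewrite !EL; split=> //; last split=> //.
  - rewrite -cat_cons lastI cat_rcons.
    apply: (adj_merged (c := c) (post := post2) _ mg).
    + by move: S3; rewrite -catA => /cat_sorted2[].
    + by rewrite cats1 -lastI.
    have: sorted (adj T D) (c :: post2) by move: adpost; rewrite Ep => /= /andP[].
    by apply: adj_mono => d dp; rewrite D3post // Ep.
  - move=> d dp; rewrite (mg_D' mg) ?D3pre //; apply: Hl.
    by rewrite mem_cat dp.
  - apply: leq_trans sz3; rewrite leq_add2r !size_cat /= leq_add2l ltnS.
    by case: (mg_adj mg) => [[_ -> _]|[-> _ _]] /=.
have cU t5 bt5 : call fMERGE (marg M T U a t4 bt4) (VPair (otree t5) (otree bt5))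
      (25 * W * Nb.+1) ->
    call fUPD (uarg root j flag) (VPair (otree t5) (otree bt5)) (100 * W * Nb.+1).
  move=> c5; have kD := reg_size_le NbE oka.
  have cj : call fPRED (VPair (otree bt) (job_word j)) (VPair (VPair (job_word (bkey a))
      (VPair (VNat R 0) (job_word (bkey a)))) (VPair (VNat R (size (D a))) (elist (D a)))) W.
    apply: (call_bpred HW rb) => //; first by rewrite kle_mkey.
    move=> c cp; apply: klt_start; move: jb (Hb c cp); rewrite /mkey /job_start /=.
    by case: (b) => //= d jd; rewrite -leNgt; apply: lt_le_trans.
  apply: pcall_body => //; apply: (@wp_let _ _ (VPair (otree t) (otree bt)) 0).
    by rewrite /uarg; case: Hroot => [->|[-> -> ->]]; ev.
  move=> n1 le1; apply: (@wp_let _ _ (epar M T U) 0).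
    by rewrite /uarg; ev; rewrite -TE -UE.
  move=> n2 le2; apply: (@wp_let _ _ (VPair (VPair (job_word (bkey a))
    (VPair (VNat R 0) (job_word (bkey a)))) (VPair (VNat R (size (D a))) (elist (D a)))) W).
    by rewrite /uarg; ev; evcall cj.
  move=> n3 le3; apply: (@wp_let _ _ (otree t1) (2 * W * (size (D a)).+1)).
    by ev; evcall c1.
  move=> n4 le4; apply: (@wp_let _ _ (otree t2) W).
    by move: c2; rewrite /uarg; case: (flag) => c2; ev; evcall c2.
  move=> n5 le5; apply: (@wp_let _ _ (eopt (omap bkey b)) W).
    by ev; evcall cnext.
  move=> n6 le6; apply: (@wp_let _ _ (VPair (otree t3) (otree bt3))
    (9 * W * (size mid).+1 + 7 * W * total D3 (a :: mid))).
    by ev; evcall cs.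
  move=> n7 le7; apply: (@wp_let _ _ (VPair (otree t4) (otree bt4)) (25 * W * Nb.+1)).
    move: c4; case: (b) => [c|] c4; ev; first by evcall c4.
    by case: c4 => -> ->.
  move=> n8 le8; ev; evcall c5; split=> //.
  have := leq_mul (leqnn W) kD; have := leq_mul (leqnn W) tot3.
  have := leq_mul (leqnn W) mid3; move: le1 le2 le3 le4 le5 le6 le7 le8.
  by set X := total _ _; clear -W0; lia.
have S4 := brep_sorted rb4.
(* Without a left neighbour, [a] is the border 0 and [MERGE] changes nothing. *)
have [Ep|[pre' [p Ep]]] : pre = [::] \/ exists pre' p, pre = pre' ++ [:: p].
  by case/lastP: (pre) => [|pre' p]; [left|right; exists pre', p; rewrite cats1].
  rewrite Ep /= in rb4 ok4 sz4 ad4; exists ks', A4, D4, (a :: mid ++ post4), t4, bt4.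
  split=> //; last first.
    apply: cU; apply: (@pcall_le _ _ _ _ _ (2 * W)); first by clear -W0; nia.
    by apply: (merge_first HW) rb4 _; clear -sz4; rewrite /= in sz4 *; lia.
  by split=> //; exists (mid ++ post4); move: Ea; rewrite Ep Es => -[<-].
rewrite Ep -catA /= in rb4 ok4 sz4 S4.
have [A5 [D5 [post5 [t5 [bt5 [mg ok5 rt5 rb5 c5]]]]]] :=
  merge_spec HW M_gt0 T_ge2 UE NbE V' Uk' rt4 rb4 sz4 ok4.
exists ks', A5, D5, (pre' ++ p :: post5), t5, bt5; split=> //; last exact: cU.
split=> //.
  case: pre' Ep {S4 rb4 ok4 sz4 rb5 ok5} => [|q pre'] Ep.
    by exists post5; move: Ea; rewrite Ep Es => -[<-].
  by exists (pre' ++ p :: post5); move: Ea; rewrite Ep Es => -[<-].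
apply: (adj_merged S4 mg) => //; rewrite -Ep.
apply: (@adj_mono _ D); first by move=> d dp; rewrite D4pre.
by move: adpre; rewrite -cats1 => /cat_sorted2[].
Qed.

End Step.
End UpdateSpec.

(** * The dynamic algorithm *)

Section DataStructure.
Variable R : realType.
Notation job := (job R).
Notation value := (value R).
Notation tree := (tree R).
Local Open Scope fset_scope.
Local Open Scope ring_scope.

Definition tree_cost (Z : nat) : nat := 10 * (2 * trunc_log 2 Z.+1 + 2).

Lemma tree_costP Z f ks (t : option tree) : trep f ks t -> (size ks <= Z)%N ->
  (10 * (ohgt t).+1 <= tree_cost Z)%N.
Proof.
move=> /trep_hgt h sz; have {}h : (2 ^ (ohgt t)./2 <= Z.+1)%N by apply: leq_trans h _.
have := trunc_log_max (isT : (1 < 2)%N) h; rewrite /tree_cost leq_pmul2l //.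
by have := odd_double_half (ohgt t); case: (odd _) => /=; lia.
Qed.

(** From [4 * n + 9 <= (n + 2) ^ 4] the logarithm is at most [4 * log2 (n + 2)], and
    [log2 (n + 2) >= 1] absorbs the constant: [10 * (8 + 2) = 100]. *)
Lemma tree_cost_ln n :
  (tree_cost (4 * n + 8))%:R <= 100 / ln (2 : R) * ln (n.+2%:R : R).
Proof.
have l2 : 0 < ln (2 : R) by rewrite ln_gt0 // ltr1n.
set l := ln n.+2%:R; set k := trunc_log 2 (4 * n + 8).+1.
have kl : k%:R * ln 2 <= 4 * l.
  rewrite mulr_natl mulr_natl -!lnXn ?ltr0n // ler_ln ?posrE ?exprn_gt0 ?ltr0n //.
  rewrite -!natrX ler_nat; apply: leq_trans (trunc_logP _ _) _ => //.
  have -> : (n.+2 ^ 4 = (n.+2 * n.+2) * (n.+2 * n.+2))%N by rewrite !expnS expn0 muln1 mulnA.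
  have h : (4 * n + 4 <= n.+2 * n.+2)%N by nia.
  by apply: leq_trans (leq_mul h h); nia.
have ll : ln 2 <= l by rewrite ler_ln ?posrE ?ltr0n // ler_nat.
rewrite mulrAC ler_pdivlMr // /tree_cost -/k natrM natrD natrM.
by nra.
Qed.

Lemma query_time_le n t :
  (t <= 20 + call_cost prog * tree_cost (4 * n + 8))%N ->
  t%:R <= (20 + 100 * (call_cost prog)%:R) / ln 2 * ln (n.+2%:R : R).
Proof.
move=> le_t; have l2 : 0 < ln (2 : R) by rewrite ln_gt0 // ltr1n.
have := tree_cost_ln n; set w := tree_cost _ in le_t *; set l := ln n.+2%:R.
have ll : ln 2 <= l by rewrite ler_ln ?posrE ?ltr0n // ler_nat.
set K := call_cost prog in le_t *; rewrite mulrAC ler_pdivlMr // => Hw.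
rewrite mulrAC ler_pdivlMr //; have HK := ler_wpM2l (ler0n R K) Hw.
apply: (@le_trans _ _ ((20 + K * w)%:R * ln 2)); first by rewrite ler_wpM2r ?ler_nat // ltW.
by rewrite natrD natrM; nra.
Qed.

Variables (M : nat) (eps : R).
Hypothesis M_gt0 : (0 < M)%N.
Hypothesis eps_gt0 : 0 < eps.

Let T : R := (M + M)%:R / eps + 2.
Let U : R := T + M%:R.
Let Nb : nat := (Num.truncn (U + 1)).+1.

Let T_ge2 : 2 <= T.
Proof. by rewrite /T lerDr divr_ge0 ?ler0n // ltW. Qed.

Let U_ge0 : 0 <= U + 1.
Proof.
have T0 : 0 <= T by apply: le_trans T_ge2; rewrite ler0n.
by rewrite addr_ge0 // addr_ge0 // ler0n.
Qed.

Let NbE : U + 1 <= Nb%:R.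
Proof. by case/andP: (truncn_itv U_ge0) => _ /ltW. Qed.

Let Nb_le : Nb%:R <= U + 2.
Proof.
by case/andP: (truncn_itv U_ge0) => le_U _; rewrite /Nb -natr1; lra.
Qed.

Notation state := (state M T U).

Definition rep (J : {fset job}) (s : schedule M J) (m : memory R) : Prop :=
  exists ks A D bs t bt, [/\ state ks A D bs t bt, root_rep (m 0%N) t bt, ks =i J &
    forall j : J, answer_word R (s j) = VNat R (A (val j))].

Definition schedule_of (A : job -> nat) (J : {fset job}) : schedule M J :=
  [ffun j : J => if A (val j) is k.+1 then insub k else None].

Lemma state_mach ks A D bs t bt : state ks A D bs t bt ->
  forall x, x \in ks -> (A x <= M)%N.
Proof.
case=> V [bs' Eb] ok _ _ rb x xk.
have Sb : bsorted bs None by rewrite bsortedN; apply: brep_sorted rb.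
by apply: (regs_mach Sb ok xk); rewrite Eb /= /inreg andbT; case/andP: (V x xk).
Qed.

Lemma schedule_ofP ks A D bs t bt (J : {fset job}) : state ks A D bs t bt -> ks =i J ->
  forall j : J, answer_word R (schedule_of A J j) = VNat R (A (val j)).
Proof.
move=> st kJ j; have := state_mach st (x := val j); rewrite kJ (valP j) => /(_ isT).
rewrite /schedule_of ffunE; case: (A (val j)) => [//|k] lt_k.
by rewrite /answer_word; case: insubP => [u _ -> //|]; rewrite lt_k.
Qed.

Lemma answer_wordP (a : option 'I_M) n : answer_word R a = VNat R n ->
  n = if a is Some k then k.+1 else 0%N.
Proof. by case=> <-. Qed.

Lemma rep_feasible (J : {fset job}) (s : schedule M J) m : rep s m -> feasible s.
Proof.
case=> ks [A [D [bs [t [bt [st _ kJ sA]]]]]]; have [V [bs' Eb] ok _ _ rb] := st.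
have Sb : bsorted bs None by rewrite bsortedN; apply: brep_sorted rb.
apply/'forall_'forall_implyP => i j /and3P[ne si /eqP sij].
have Ai := answer_wordP (sA i); have Aj := answer_wordP (sA j).
have inb (x : J) : inside bs None (val x).
  rewrite Eb /= /inreg andbT.
  by have /V/andP[] : val x \in ks by rewrite kJ (valP x).
have ik (x : J) : val x \in ks by rewrite kJ (valP x).
apply: (regs_feasible Sb ok (ik i) (ik j) (inb i) (inb j)) => //.
- by rewrite Ai; case: (s i) si.
- by rewrite Aj -sij; case: (s i) si.
- by rewrite Ai Aj sij.
Qed.

Lemma rep_approximate (J : {fset job}) (s : schedule M J) m :
  rep s m -> approximate eps s.
Proof.
case=> ks [A [D [bs [t [bt [st _ kJ sA]]]]]]; have [V [bs' Eb] ok ad rt rb] := st.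
have Sb : bsorted bs None by rewrite bsortedN; apply: brep_sorted rb.
have Uk : uniq ks by case: rt => _ /klt_sorted_uniq.
have inb x : x \in ks -> inside bs None x.
  by move=> xk; rewrite Eb /= /inreg andbT; case/andP: (V x xk).
have sz (r : schedule M J) : schedule_value r =
    size [seq val j | j <- enum [pred j | r j != None]].
  by rewrite size_map -cardE.
have val_s : schedule_value s = total D bs.
  rewrite sz (regs_count Uk Sb ok) -size_filter; apply/perm_size/uniq_perm.
  - by rewrite (map_inj_uniq val_inj) enum_uniq.
  - exact: filter_uniq.
  move=> x; rewrite mem_filter; apply/mapP/idP => [[j]|/andP[/andP[Ax _] xk]].
    rewrite mem_enum inE => sj ->; have jk : val j \in ks by rewrite kJ (valP j).
    by rewrite jk inb // (answer_wordP (sA j)); case: (s j) sj.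
  have xJ : x \in J by rewrite -kJ.
  exists [` xJ] => //; rewrite mem_enum inE.
  by have := answer_wordP (sA [` xJ]); move: Ax => /= /eqP; case: (s _).
have opt_le : (opt_value M J <= total D bs + M * (size bs).-1)%N.
  apply/bigmax_leqP => r /'forall_'forall_implyP Fr; rewrite sz.
  (* The default machine 0 is never consulted, because [g] is only used on jobs scheduled by [r]. *)
  pose g x := if insub x : option J is Some j then
    (if r j is Some k then nat_of_ord k else 0%N) else 0%N.
  have gE (j : J) k : r j = Some k -> g (val j) = k by rewrite /g valK => ->.
  apply: (@optimal_size R M U ks A D bs None _ g V Sb ok).
    split.
    - by rewrite (map_inj_uniq val_inj) enum_uniq.
    - move=> x /mapP[j]; rewrite mem_enum inE => rj ->.
      by case E: (r j) rj => [k|//] _; rewrite (gE _ _ E).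
    move=> x y /mapP[i ri ->] /mapP[j rj ->] ne.
    rewrite !mem_enum !inE in ri rj.
    case Ei: (r i) ri => [k|//] _; case Ej: (r j) rj => [h|//] _.
    rewrite (gE _ _ Ei) (gE _ _ Ej) => /ord_inj Ekh.
    apply: Fr; rewrite Ei Ej Ekh eqxx /= andbT.
    by apply: contra ne => /eqP ->.
  by move=> _ /mapP[j _ ->]; rewrite kJ (valP j) /= inb // kJ (valP j).
rewrite /approximate val_s; have e1 : 0 < 1 + eps by rewrite ltr_wpDl.
rewrite mulrC ler_pdivrMr //.
have := adj_total ad; set B := (size bs).-1; set N := total D bs.
move=> HB; apply: (@le_trans _ _ (N + M * B)%:R); first by rewrite ler_nat.
(* As [T >= 2 M / eps], the bound [B T <= 2 N] turns into [M B <= eps N], the whole loss at the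
   inner borders. *)
have HM : (M + M)%:R * B%:R <= (2 * N)%:R * eps.
  apply: le_trans (ler_wpM2r (ltW eps_gt0) HB).
  rewrite /T mulrDr mulrDl -mulrA divfK ?gt_eqF // mulrC lerDl.
  by rewrite !mulr_ge0 ?ler0n // ltW.
move: HM; rewrite !natrD !natrM; lra.
Qed.

Lemma initial_rep : rep (schedule_of (fun=> 0%N) fset0) (empty_memory R).
Proof.
exists [::], (fun=> 0%N), (fun=> [::]), [:: 0], None, (root0 R); split=> //.
- exact: state0.
- by right.
by move=> j; have := valP j; rewrite inE.
Qed.

Lemma rep_card ks (J : {fset job}) : uniq ks -> ks =i J -> size ks = #|` J|.
Proof. by move=> Uk kJ; apply/perm_size/uniq_perm; rewrite ?fset_uniq. Qed.

Lemma rep_update (J J' : {fset job}) (s : schedule M J) m j (flag : bool) :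
  rep s m -> valid_job j -> (j \notin J) = flag ->
  (forall x, (x \in J') = if flag then (x == j) || (x \in J) else (x != j) && (x \in J)) ->
  exists v m' t (s' : schedule M J'),
    [/\ run scheduler (update_code flag) eps M m j v m' t,
        (t <= 20 + call_cost prog * (100 * tree_cost (4 * #|` J| + 8) * Nb.+1))%N &
        rep s' m'].
Proof.
case=> ks [A [D [bs [t [bt [st Hm kJ _]]]]]] jV jJ J'E.
have Uk : uniq ks by case: (st_t st) => _ /klt_sorted_uniq.
rewrite -(rep_card Uk kJ).
have [||ks' [A' [D' [bs' [t' [bt' [st' kE [_ cU]]]]]]]] :=
  update_spec (@tree_costP (4 * size ks + 8)) M_gt0 T_ge2 erefl erefl NbE st jV
    (flag := flag) _ _ Hm; [by rewrite kJ|by []|].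
have [tU le_t ev] := cU m.
have [ta le_ta earg] : exists2 ta, (ta <= 10)%N &
    eval prog [:: job_word j; VNat R M; VReal eps] m
    (Op2 MkPair (Fetch (NatLit 0)) (Op2 MkPair (Var 0) (Op2 MkPair (Var 1)
      (Op2 MkPair (Var 2) (NatLit flag))))) (uarg M eps (m 0%N) j flag) m ta.
  eexists; last first.
    eapply EvOp2; [eapply EvLoad; eapply EvNat | | reflexivity].
    eapply EvOp2; [by eapply EvVar | | reflexivity].
    eapply EvOp2; [by eapply EvVar | | reflexivity].
    eapply EvOp2; [by eapply EvVar | | reflexivity].
    by eapply EvNat.
  by [].
have kJ' : ks' =i J' by move=> x; rewrite kE J'E kJ.
exists (VNull R), (write m 0 (VPair (otree t') (otree bt'))), (1 + (ta + tU).+1).+1,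
  (schedule_of A' J').
split.
- exact: EvStore (EvNat _ _ _ _) (EvCall _ earg ev).
- by apply: (@leq_trans (20 + tU)); [move: le_ta; clear; lia | rewrite leq_add2l].
exists ks', A', D', bs', t', bt'; split=> //; first by left.
exact: schedule_ofP st' kJ'.
Qed.

Lemma rep_query (J : {fset job}) (s : schedule M J) m (j : J) : rep s m ->
  exists t, run scheduler (query_code scheduler) eps M m (val j) (answer_word R (s j)) m t /\
    (t <= 20 + call_cost prog * tree_cost (4 * #|` J| + 8))%N.
Proof.
case=> ks [A [D [bs [t [bt [st Hm kJ sA]]]]]].
have Uk : uniq ks by case: (st_t st) => _ /klt_sorted_uniq.
have jk : val j \in ks by rewrite kJ (valP j).
have Em : m 0%N = VPair (otree t) (otree bt).
  case: Hm => // -[_ Et _]; have [_ _] := st_t st; rewrite Et /=.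
  by case: (ks) jk.
rewrite -(rep_card Uk kJ).
have [|x [_ cx]] := call_tpred (@tree_costP (4 * size ks + 8)) (val j)
  (f := jleaf A) (fun=> erefl) (st_t st); first by clear; lia.
have [tq le_t ev] := cx m.
case: x ev {cx} => [x|] ev; last by move=> /(_ _ jk); rewrite klt_irr.
(* The greatest key not above a present key is that key, so the predecessor search finds the leaf of
   [j] and its payload is the answer. *)
case=> y [Ex yk le_y ymax]; have Ey : y = val j.
  by apply: kle_anti; rewrite le_y ymax ?kle_refl.
subst x y; exists (5 + tq).+2; split; last by apply: (@leq_trans (20 + tq)); [clear; lia | rewrite leq_add2l].
rewrite sA; apply: (@EvOp1 _ _ _ _ _ _ _ (eleaf (jleaf A (val j)))); last by [].
apply: EvCall ev => //.
eapply (@EvOp2 _ _ _ _ _ _ _ _ _ _ _ _ 3 1); [|by eapply EvVar|reflexivity].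
eapply EvOp1; [eapply EvLoad; eapply EvNat | by rewrite Em].
Qed.

(** The bound on [eps] lets the summands of [U] that lack the factor [1 / eps] be absorbed:
    [M <= eps_max * (M / eps)]. *)
Lemma update_time_le eps_max n t : eps <= eps_max ->
  (t <= 20 + call_cost prog * (100 * tree_cost (4 * n + 8) * Nb.+1))%N ->
  t%:R <= (20 * eps_max + 10000 * (2 + 6 * eps_max) * (call_cost prog)%:R) / ln 2 *
    (M%:R * ln (n.+2%:R : R) / eps).
Proof.
move=> le_eps le_t; have l2 : 0 < ln (2 : R) by rewrite ln_gt0 // ltr1n.
have := tree_cost_ln n; set w := tree_cost _ in le_t *; set l := ln n.+2%:R.
have ll : ln 2 <= l by rewrite ler_ln ?posrE ?ltr0n // ler_nat.
set K := call_cost prog in le_t *; rewrite mulrAC ler_pdivlMr // => Hw.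
set mu := M%:R / eps; have -> : M%:R * l / eps = mu * l by rewrite /mu mulrAC.
have M1 : 1 <= M%:R :> R by rewrite ler1n.
have Hmu : M%:R <= eps_max * mu.
  by rewrite /mu mulrCA ler_peMr ?(le_trans _ M1) // ler_pdivlMr ?mul1r.
(* With [M >= 1], [Nb + 1 <= 2 mu + M + 5 <= 2 mu + 6 M]. *)
have HN : Nb.+1%:R <= (2 + 6 * eps_max) * mu.
  rewrite -natr1; move: Nb_le; rewrite /U /T natrD mulrDl -/mu; lra.
rewrite mulrAC ler_pdivlMr //.
have mu0 : 0 <= mu by rewrite divr_ge0 ?ler0n // ltW.
have e0 : 0 <= eps_max by apply: ltW; apply: lt_le_trans le_eps.
have Hwl : w%:R * Nb.+1%:R * ln 2 <= 100 * l * ((2 + 6 * eps_max) * mu).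
  rewrite mulrAC ler_pM ?mulr_ge0 ?ler0n // ltW //.
have K0 : 0 <= K%:R :> R by rewrite ler0n.
have HK := ler_wpM2l K0 Hwl.
have H20 : ln 2 <= eps_max * mu * l.
  by apply: (le_trans ll); rewrite ler_peMl ?(le_trans (ltW l2)) // (le_trans M1).
apply: (@le_trans _ _ ((20 + K * (100 * w * Nb.+1))%:R * ln 2)).
  by rewrite ler_wpM2r ?ler_nat // ltW.
have -> : (20 + K * (100 * w * Nb.+1))%:R =
    20 + 100 * (K%:R * (w%:R * Nb.+1%:R)) :> R.
  have E : (100 * w * Nb.+1)%:R = 100%:R * (w%:R * Nb.+1%:R) :> R.
    by rewrite natrM natrM -mulrA.
  by rewrite natrD natrM E mulrCA.
move: H20 HK; clear; move: (K%:R) (w%:R) (Nb.+1%:R) (ln 2) l mu => k v N x y z H1 H2.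
nra.
Qed.

End DataStructure.

Local Open Scope ring_scope.

Theorem theorem4 (R : realType) :
  exists A : algorithm, forall eps_max : R, 0 < eps_max ->
  exists C : R, forall (eps : R) (M : nat), 0 < eps <= eps_max -> (0 < M)%N ->
    dynamic_scheduling A eps M
      (fun n : nat => C * (M%:R * ln (n.+2%:R : R) / eps))
      (fun n : nat => C * ln (n.+2%:R : R)).
Proof.
exists scheduler => eps_max emax_gt0; pose K : R := (call_cost prog)%:R.
have l2 : 0 < ln (2 : R) by rewrite ln_gt0 // ltr1n.
have K0 : 0 <= K by rewrite ler0n.
pose Cu := (20 * eps_max + 10000 * (2 + 6 * eps_max) * K) / ln 2.
pose Cq := (20 + 100 * K) / ln 2.
have Cu0 : 0 <= Cu by rewrite divr_ge0 ?(ltW l2) //; nra.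
have Cq0 : 0 <= Cq by rewrite divr_ge0 ?(ltW l2) //; nra.
exists (Cu + Cq) => eps M /andP[eps_gt0 le_eps] M_gt0.
have ln0 n : 0 <= ln (n.+2%:R : R) by rewrite ln_ge0 // ler1n.
have up n t : t%:R <= Cu * (M%:R * ln (n.+2%:R : R) / eps) ->
    t%:R <= (Cu + Cq) * (M%:R * ln (n.+2%:R : R) / eps).
  move=> /le_trans; apply; rewrite ler_wpM2r ?lerDl //.
  by rewrite divr_ge0 ?mulr_ge0 ?ler0n // ltW.
exists (fun J s m => rep eps s m); split.
- by exists (schedule_of M (fun=> 0%N) fset0); apply: initial_rep.
- move=> J s m rs; split; first exact: rep_feasible rs.
  exact: (rep_approximate eps_gt0 rs).
- move=> J s m j rs jV jJ.
  have [|v [m' [t [s' [ru le_t rs']]]]] :=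
    rep_update (J' := (j |` J)%fset) M_gt0 eps_gt0 rs jV jJ; first by move=> x; rewrite !inE.
  by exists v, m', t, s'; split=> //; apply/up/(update_time_le M_gt0).
- move=> J s m j rs jJ.
  have jV : valid_job j.
    by case: rs => ks [A [D [bs [t [bt [[V _ _ _ _ _] _ kJ _]]]]]]; apply: V; rewrite kJ.
  have [||v [m' [t [s' [ru le_t rs']]]]] :=
    rep_update (J' := (J `\ j)%fset) (flag := false) M_gt0 eps_gt0 rs jV.
  + by rewrite jJ.
  + by move=> x; rewrite !inE.
  by exists v, m', t, s'; split=> //; apply/up/(update_time_le M_gt0).
- move=> J s m j rs; have [t [rq le_t]] := rep_query j rs.
  exists m, t; split=> //; apply: le_trans (query_time_le R le_t) _.
  by rewrite ler_wpM2r // lerDr.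
Qed.
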